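(* Assume that $\mathbb{F}$ is algebraically closed and $q$ is not a root of unity. Let $d\geq1$ be an odd integer. Let $\mathbf{EM}_d$ denote the set of all isomorphism classes of irreducible $\mathfrak{H}_q$-modules of dimension $d+1$. Let $\mathbf{EP}_d$ denote the set of all quadruples $(k_0,k_1,k_2,k_3)$ of nonzero scalars in $\mathbb{F}$ that satisfy $k_0^2=q^{-d-1}$ and $$k_0k_1k_2k_3,\ k_0k_1^{-1}k_2k_3,\ k_0k_1k_2^{-1}k_3,\ k_0k_1k_2k_3^{-1}\ \neq\ q^{-i}\qquad\text{for all } i=1,3,\ldots,d.$$ Define an action of the abelian group $\{\pm1\}^3$ on $\mathbf{EP}_d$ by $(k_0,k_1,k_2,k_3)^{(-1,1,1)}=(k_0,k_1^{-1},k_2,k_3)$, $(k_0,k_1,k_2,k_3)^{(1,-1,1)}=(k_0,k_1,k_2^{-1},k_3)$, $(k_0,k_1,k_2,k_3)^{(1,1,-1)}=(k_0,k_1,k_2,k_3^{-1})$. Let $\mathbf{EP}_d/\{\pm1\}^3$ denote the set of $\{\pm1\}^3$-orbits of $\mathbf{EP}_d$, and let $[k_0,k_1,k_2,k_3]$ denote the orbit containing $(k_0,k_1,k_2,k_3)$. Then there exists a bijection $\mathcal{E}:\mathbb{Z}/4\mathbb{Z}\times\mathbf{EP}_d/\{\pm1\}^3\to\mathbf{EM}_d$ given by $$(\varepsilon,[k_0,k_1,k_2,k_3])\mapsto\text{the isomorphism class of } E(k_0,k_1,k_2,k_3)^{\varepsilon}$$ for all $\varepsilon\in\mathbb{Z}/4\mathbb{Z}$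 and all $[k_0,k_1,k_2,k_3]\in\mathbf{EP}_d/\{\pm1\}^3$.
   Context: $\mathbb{F}$ is a field and $q\in\mathbb{F}$ is nonzero. The universal DAHA $\mathfrak{H}_q$ of type $(C_1^\vee,C_1)$ is the unital associative $\mathbb{F}$-algebra with generators $t_0^{\pm1},t_1^{\pm1},t_2^{\pm1},t_3^{\pm1}$ and relations: $t_it_i^{-1}=t_i^{-1}t_i=1$ for all $i$; $t_i+t_i^{-1}$ is central for all $i$; $t_0t_1t_2t_3=q^{-1}$. The group $\mathbb{Z}/4\mathbb{Z}$ acts on $\mathfrak{H}_q$ by $\mathbb{F}$-algebra automorphisms: $\varepsilon\in\mathbb{Z}/4\mathbb{Z}$ sends $t_i\mapsto t_{i+\varepsilon}$ (indices mod $4$). For an $\mathfrak{H}_q$-module $V$, $V^\varepsilon$ denotes the module obtained by twisting $V$ via $\varepsilon$: the same vector space, with $x\in\mathfrak{H}_q$ acting on $V^\varepsilon$ as $\varepsilon(x)$ acts on $V$. For an odd integer $d\ge1$ and nonzero $k_0,k_1,k_2,k_3\in\mathbb{F}$ with $k_0^2=q^{-d-1}$, $E(k_0,k_1,k_2,k_3)$ denotes the $(d+1)$-dimensional $\mathfrak{H}_q$-module with $\mathbb{F}$-basis $\{v_i\}_{i=0}^d$ and action - $t_0v_i=k_0^{-1}q^{-i}(1-q^i)(1-k_0^2q^i)v_{i-1}+(k_0+k_0^{-1}-k_0^{-1}q^{-i})v_i$ for $i=2,4,\ldots,d-1$; $t_0v_i=k_0^{-1}q^{-i-1}(v_i-v_{i+1})$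 for $i=1,3,\ldots,d-2$; $t_0v_0=k_0v_0$; $t_0v_d=k_0v_d$; - $t_1v_i=-k_1(1-q^i)(1-k_0^2q^i)v_{i-1}+k_1v_i+k_1^{-1}v_{i+1}$ for $i=2,4,\ldots,d-1$; $t_1v_i=k_1^{-1}v_i$ for $i=1,3,\ldots,d$; $t_1v_0=k_1v_0+k_1^{-1}v_1$; - $t_2v_i=k_0^{-1}k_1^{-1}k_3^{-1}q^{-i-1}(v_i-v_{i+1})$ for $i=0,2,\ldots,d-1$; $t_2v_i=\frac{(k_0k_1k_3q^i-k_2)(k_0k_1k_3q^i-k_2^{-1})}{k_0k_1k_3q^i}v_{i-1}+(k_2+k_2^{-1}-k_0^{-1}k_1^{-1}k_3^{-1}q^{-i})v_i$ for $i=1,3,\ldots,d$; - $t_3v_i=k_3v_i$ for $i=0,2,\ldots,d-1$; $t_3v_i=-k_3^{-1}(k_0k_1k_3q^i-k_2)(k_0k_1k_3q^i-k_2^{-1})v_{i-1}+k_3^{-1}v_i+k_3v_{i+1}$ for $i=1,3,\ldots,d-2$; $t_3v_d=-k_3^{-1}(k_0k_1k_3q^d-k_2)(k_0k_1k_3q^d-k_2^{-1})v_{d-1}+k_3^{-1}v_d$. (These formulas do define an $\mathfrak{H}_q$-module.) *)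

(* Defs.v *)
From HB Require Import structures.
From mathcomp Require Import all_boot all_order all_algebra.
From mathcomp Require Import ring.
From mathcomp Require Import boolp classical_sets functions.

Set Implicit Arguments.
Unset Strict Implicit.
Unset Printing Implicit Defensive.

Import GRing.Theory.
Local Open Scope ring_scope.
Local Open Scope quotient_scope.

Section PresentedAlgebra.
Context {F : fieldType} {I : Type}.

Inductive alg_term : Type :=
| TGen of I
| TScal of F
| TAdd of alg_term & alg_term
| TMul of alg_term & alg_term.

HB.instance Definition _ := gen_eqMixin alg_term.
HB.instance Definition _ := gen_choiceMixin alg_term.

(* The least congruence for which the quotient is a unital associative
   F-algebra satisfying R; TScal a is the scalar multiple a of the unit. *)
Inductive pres_eq (R : alg_term -> alg_term -> Prop) :
  alg_term -> alg_term -> Prop :=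
| PresRel x y of R x y : pres_eq R x y
| PresRefl x : pres_eq R x x
| PresSym x y of pres_eq R x y : pres_eq R y x
| PresTrans x y z of pres_eq R x y & pres_eq R y z : pres_eq R x z
| PresCongD x x' y y' of pres_eq R x x' & pres_eq R y y' :
    pres_eq R (TAdd x y) (TAdd x' y')
| PresCongM x x' y y' of pres_eq R x x' & pres_eq R y y' :
    pres_eq R (TMul x y) (TMul x' y')
| PresAddA x y z : pres_eq R (TAdd x (TAdd y z)) (TAdd (TAdd x y) z)
| PresAddC x y : pres_eq R (TAdd x y) (TAdd y x)
| PresAdd0 x : pres_eq R (TAdd (TScal 0) x) x
| PresAddN x : pres_eq R (TAdd (TMul (TScal (-1)) x) x) (TScal 0)
| PresMulA x y z : pres_eq R (TMul x (TMul y z)) (TMul (TMul x y) z)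
| PresMul1l x : pres_eq R (TMul (TScal 1) x) x
| PresMul1r x : pres_eq R (TMul x (TScal 1)) x
| PresMulDl x y z : pres_eq R (TMul (TAdd x y) z) (TAdd (TMul x z) (TMul y z))
| PresMulDr x y z : pres_eq R (TMul x (TAdd y z)) (TAdd (TMul x y) (TMul x z))
| PresScalD a b : pres_eq R (TScal (a + b)) (TAdd (TScal a) (TScal b))
| PresScalM a b : pres_eq R (TScal (a * b)) (TMul (TScal a) (TScal b))
| PresScalC a x : pres_eq R (TMul (TScal a) x) (TMul x (TScal a)).

Variable R : alg_term -> alg_term -> Prop.

Definition pres_eqb (x y : alg_term) : bool := `[< pres_eq R x y >].

Lemma pres_eqb_equiv : equiv_class_of pres_eqb.
Proof.
split.
- by move=> x; apply/asboolP; exact: PresRefl.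
- by move=> x y; apply/asboolP/asboolP; exact: PresSym.
- by move=> y x z /asboolP xy /asboolP yz; apply/asboolP; exact: PresTrans yz.
Qed.

Canonical pres_equiv := EquivRelPack pres_eqb_equiv.
Definition presented := {eq_quot pres_eqb}.
HB.instance Definition _ := Choice.on presented.
HB.instance Definition _ : EqQuotient alg_term pres_eqb presented :=
  EqQuotient.on presented.

Definition pcls (x : alg_term) : presented := \pi_presented x.

Lemma pcls_eq x y : pres_eq R x y <-> pcls x = pcls y.
Proof.
split=> [xy|]; first by apply/eqmodP/asboolP.
by move=> /eqmodP /asboolP.
Qed.

Lemma pcls_repr (x : presented) : pcls (repr x) = x.
Proof. exact: reprK. Qed.

Lemma repr_pcls x : pres_eq R (repr (pcls x)) x.
Proof. by apply/pcls_eq; rewrite pcls_repr. Qed.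

Lemma pclsW (P : presented -> Prop) : (forall x, P (pcls x)) -> forall x, P x.
Proof. by move=> h x; rewrite -(pcls_repr x). Qed.

Definition pres_add (x y : presented) := pcls (TAdd (repr x) (repr y)).
Definition pres_mul (x y : presented) := pcls (TMul (repr x) (repr y)).
Definition pres_opp (x : presented) := pcls (TMul (TScal (-1)) (repr x)).
Definition pres_scale (a : F) (x : presented) := pcls (TMul (TScal a) (repr x)).

Lemma pres_addE x y : pres_add (pcls x) (pcls y) = pcls (TAdd x y).
Proof. by apply/pcls_eq/PresCongD; exact: repr_pcls. Qed.
Lemma pres_mulE x y : pres_mul (pcls x) (pcls y) = pcls (TMul x y).
Proof. by apply/pcls_eq/PresCongM; exact: repr_pcls. Qed.
Lemma pres_oppE x : pres_opp (pcls x) = pcls (TMul (TScal (-1)) x).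
Proof. by apply/pcls_eq/PresCongM; [exact: PresRefl|exact: repr_pcls]. Qed.
Lemma pres_scaleE a x : pres_scale a (pcls x) = pcls (TMul (TScal a) x).
Proof. by apply/pcls_eq/PresCongM; [exact: PresRefl|exact: repr_pcls]. Qed.

Fact pres_addA : associative pres_add.
Proof.
elim/pclsW=> x; elim/pclsW=> y; elim/pclsW=> z.
by rewrite !pres_addE; apply/pcls_eq/PresAddA.
Qed.
Fact pres_addC : commutative pres_add.
Proof.
elim/pclsW=> x; elim/pclsW=> y.
by rewrite !pres_addE; apply/pcls_eq/PresAddC.
Qed.
Fact pres_add0 : left_id (pcls (TScal 0)) pres_add.
Proof. by elim/pclsW=> x; rewrite pres_addE; apply/pcls_eq/PresAdd0. Qed.
Fact pres_addN : left_inverse (pcls (TScal 0)) pres_opp pres_add.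
Proof.
by elim/pclsW=> x; rewrite pres_oppE pres_addE; apply/pcls_eq/PresAddN.
Qed.

HB.instance Definition _ :=
  GRing.isZmodule.Build presented pres_addA pres_addC pres_add0 pres_addN.

Fact pres_mulA : associative pres_mul.
Proof.
elim/pclsW=> x; elim/pclsW=> y; elim/pclsW=> z.
by rewrite !pres_mulE; apply/pcls_eq/PresMulA.
Qed.
Fact pres_mul1l : left_id (pcls (TScal 1)) pres_mul.
Proof. by elim/pclsW=> x; rewrite pres_mulE; apply/pcls_eq/PresMul1l. Qed.
Fact pres_mul1r : right_id (pcls (TScal 1)) pres_mul.
Proof. by elim/pclsW=> x; rewrite pres_mulE; apply/pcls_eq/PresMul1r. Qed.
Fact pres_mulDl : left_distributive pres_mul +%R.
Proof.
elim/pclsW=> x; elim/pclsW=> y; elim/pclsW=> z; rewrite /GRing.add /=.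
by rewrite !(pres_mulE, pres_addE); apply/pcls_eq/PresMulDl.
Qed.
Fact pres_mulDr : right_distributive pres_mul +%R.
Proof.
elim/pclsW=> x; elim/pclsW=> y; elim/pclsW=> z; rewrite /GRing.add /=.
by rewrite !(pres_mulE, pres_addE); apply/pcls_eq/PresMulDr.
Qed.

HB.instance Definition _ := GRing.Zmodule_isPzRing.Build presented
  pres_mulA pres_mul1l pres_mul1r pres_mulDl pres_mulDr.

Lemma pclsD x y : pcls (TAdd x y) = pcls x + pcls y.
Proof. by rewrite -pres_addE. Qed.
Lemma pclsM x y : pcls (TMul x y) = pcls x * pcls y.
Proof. by rewrite -pres_mulE. Qed.
Lemma pcls0 : pcls (TScal 0) = 0. Proof. by []. Qed.
Lemma pcls1 : pcls (TScal 1) = 1. Proof. by []. Qed.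

Fact pres_scaleA a b x :
  pres_scale a (pres_scale b x) = pres_scale (a * b) x.
Proof.
elim/pclsW: x => x; rewrite !pres_scaleE.
rewrite !pclsM (_ : pcls (TScal (a * b)) = pcls (TScal a) * pcls (TScal b)).
  exact: mulrA.
by rewrite -pclsM; apply/pcls_eq/PresScalM.
Qed.
Fact pres_scale1 : left_id 1 pres_scale.
Proof. by elim/pclsW=> x; rewrite pres_scaleE pclsM mul1r. Qed.
Fact pres_scaleDr : right_distributive pres_scale +%R.
Proof.
move=> a; elim/pclsW=> x; elim/pclsW=> y.
by rewrite -pclsD !pres_scaleE !(pclsM, pclsD) mulrDr.
Qed.
Fact pres_scaleDl x : {morph pres_scale^~ x : a b / a + b}.
Proof.
elim/pclsW: x => x a b; rewrite !pres_scaleE !pclsM -mulrDl -pclsD.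
by congr (_ * _); apply/pcls_eq/PresScalD.
Qed.

HB.instance Definition _ := GRing.Zmodule_isLmodule.Build F presented
  pres_scaleA pres_scale1 pres_scaleDr pres_scaleDl.

Lemma pres_scalE a (x : presented) : a *: x = pcls (TScal a) * x.
Proof. by elim/pclsW: x => x; rewrite -pclsM -pres_scaleE. Qed.

Fact pres_scalerAl a (x y : presented) : a *: (x * y) = (a *: x) * y.
Proof. by rewrite !pres_scalE mulrA. Qed.

Fact pres_scalC a (x : presented) : pcls (TScal a) * x = x * pcls (TScal a).
Proof.
by elim/pclsW: x => x; rewrite -!pclsM; apply/pcls_eq/PresScalC.
Qed.

Fact pres_scalerAr a (x y : presented) : a *: (x * y) = x * (a *: y).
Proof. by rewrite !pres_scalE mulrA pres_scalC !mulrA. Qed.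

Section Universal.
Variables (A : algType F) (g : I -> A).

Fixpoint term_eval (x : alg_term) : A :=
  match x with
  | TGen i => g i
  | TScal a => a%:A
  | TAdd x y => term_eval x + term_eval y
  | TMul x y => term_eval x * term_eval y
  end.

Definition respects := forall x y, R x y -> term_eval x = term_eval y.

Hypothesis gR : respects.

Lemma term_eval_eq x y : pres_eq R x y -> term_eval x = term_eval y.
Proof.
elim=> /=; first by move=> *; exact: gR.
- by [].
- by [].
- by move=> ? ? ? _ -> _ ->.
- by move=> ? ? ? ? _ -> _ ->.
- by move=> ? ? ? ? _ -> _ ->.
- by move=> *; exact: addrA.
- by move=> *; exact: addrC.
- by move=> *; rewrite scale0r add0r.
- by move=> *; rewrite scaleN1r mulN1r addNr scale0r.
- by move=> *; exact: mulrA.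
- by move=> *; rewrite scale1r mul1r.
- by move=> *; rewrite scale1r mulr1.
- by move=> *; exact: mulrDl.
- by move=> *; exact: mulrDr.
- by move=> *; exact: scalerDl.
- by move=> *; rewrite mulr_algl scalerA.
- by move=> *; rewrite mulr_algl mulr_algr.
Qed.

Definition pres_lift (x : presented) : A := term_eval (repr x).

Lemma pres_liftE x : pres_lift (pcls x) = term_eval x.
Proof. exact/term_eval_eq/repr_pcls. Qed.

Lemma pres_liftD : {morph pres_lift : x y / x + y}.
Proof.
by elim/pclsW=> x; elim/pclsW=> y; rewrite -pclsD !pres_liftE.
Qed.
Lemma pres_liftM : {morph pres_lift : x y / x * y}.
Proof.
by elim/pclsW=> x; elim/pclsW=> y; rewrite -pclsM !pres_liftE.
Qed.
Lemma pres_lift0 : pres_lift 0 = 0.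
Proof. by rewrite -pcls0 pres_liftE /= scale0r. Qed.
Lemma pres_lift1 : pres_lift 1 = 1.
Proof. by rewrite -pcls1 pres_liftE /= scale1r. Qed.
Lemma pres_liftZ : scalable pres_lift.
Proof. by move=> a x; rewrite pres_scalE pres_liftM pres_liftE /= mulr_algl. Qed.

End Universal.

End PresentedAlgebra.
Arguments alg_term F I : clear implicits.

Section DAHA.
Context {F : fieldType}.

Inductive daha_gen : Type := Gent of 'Z_4 | GentV of 'Z_4.

(* t_i^{-1} is the generator GentV i; the indices are taken modulo 4. *)
Inductive daha_rel (q : F) :
  alg_term F daha_gen -> alg_term F daha_gen -> Prop :=
| DahaMulV i : daha_rel q (TMul (TGen (Gent i)) (TGen (GentV i))) (TScal 1)
| DahaVMul i : daha_rel q (TMul (TGen (GentV i)) (TGen (Gent i))) (TScal 1)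
| DahaCentral i x :
    daha_rel q (TMul (TAdd (TGen (Gent i)) (TGen (GentV i))) x)
               (TMul x (TAdd (TGen (Gent i)) (TGen (GentV i))))
| DahaProd :
    daha_rel q (TMul (TMul (TMul (TGen (Gent 0)) (TGen (Gent 1)))
                           (TGen (Gent 2))) (TGen (Gent 3)))
               (TScal q^-1).

Definition daha_pres (q : F) := presented (daha_rel q).

(* q enters through the proof hq, which makes the algebra nonzero. *)
Definition daha (q : F) (hq : q != 0) : Type := daha_pres q.

Section Structure.
Variables (A : algType F) (q : F) (u v : 'Z_4 -> A).

Definition daha_data : Prop :=
  [/\ forall i, u i * v i = 1,
      forall i, v i * u i = 1,
      forall i j, GRing.comm (u i + v i) (u j)
    & u 0 * u 1 * u 2 * u 3 = q^-1%:A].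

Definition daha_val (g : daha_gen) : A :=
  match g with Gent i => u i | GentV i => v i end.

Lemma daha_respects : daha_data -> respects (daha_rel q) daha_val.
Proof.
case=> uv vu uC uP x y [] /= {x y}.
- by move=> i; rewrite uv scale1r.
- by move=> i; rewrite vu scale1r.
- move=> i x; rewrite -[_ = _]/(GRing.comm _ _).
  elim: x => [[] j|a|x cx y cy|x cx y cy] /=.
  + exact: uC.
  + have uCi : u j * (u i + v i) = (u i + v i) * u j by rewrite uC.
    rewrite /GRing.comm -[LHS]mul1r -(vu j) -mulrA (mulrA (u j)) uCi.
    by rewrite -!mulrA uv mulr1.
  + by rewrite /GRing.comm mulr_algl mulr_algr.
  + exact: commrD.
  + exact: commrM.
- exact: uP.
Qed.

End Structure.

Section Instances.
Variables (q : F) (hq : q != 0).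

Lemma daha_nonzero : (1 : daha_pres q) != 0.
Proof.
pose u (i : 'Z_4) : F^o := if i == 0 then q^-1 else 1.
pose v (i : 'Z_4) : F^o := if i == 0 then q else 1.
have uvD : daha_data q u v.
  split=> [i|i|i j|]; rewrite /u /v.
  - by case: ifP => _; rewrite ?mulVf ?mulr1.
  - by case: ifP => _; rewrite ?mulfV ?mulr1.
  - exact: mulrC.
  - by rewrite /= !mulr1 [RHS]mulr1.
apply/eqP=> /(congr1 (pres_lift (daha_val u v))).
rewrite (pres_lift1 (daha_respects uvD)) (pres_lift0 (daha_respects uvD)).
by apply/eqP/oner_neq0.
Qed.

HB.instance Definition _ := GRing.PzRing.on (daha hq).
HB.instance Definition _ := GRing.Lmodule.on (daha hq).
HB.instance Definition _ :=
  GRing.PzSemiRing_isNonZero.Build (daha hq) daha_nonzero.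
HB.instance Definition _ := GRing.Lmodule_isLalgebra.Build F (daha hq)
  (@pres_scalerAl _ _ (daha_rel q)).
HB.instance Definition _ := GRing.Lalgebra_isAlgebra.Build F (daha hq)
  (@pres_scalerAr _ _ (daha_rel q)).

Definition dcls (x : alg_term F daha_gen) : daha hq := pcls (daha_rel q) x.
Definition daha_t (i : 'Z_4) : daha hq := dcls (TGen (Gent i)).
Definition daha_tV (i : 'Z_4) : daha hq := dcls (TGen (GentV i)).

Lemma dclsD x y : dcls (TAdd x y) = dcls x + dcls y.
Proof. exact: (pclsD (daha_rel q)). Qed.
Lemma dclsM x y : dcls (TMul x y) = dcls x * dcls y.
Proof. exact: (pclsM (daha_rel q)). Qed.
Lemma dcls1 : dcls (TScal 1) = 1. Proof. by []. Qed.
Lemma dclsS a : dcls (TScal a) = a%:A.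
Proof. by rewrite [RHS](pres_scalE (R := daha_rel q)) [RHS]mulr1. Qed.
Lemma dcls_rel x y : daha_rel q x y -> dcls x = dcls y.
Proof. by move=> h; apply/pcls_eq/PresRel. Qed.
Lemma dclsW (P : daha hq -> Prop) : (forall x, P (dcls x)) -> forall x, P x.
Proof. exact: (@pclsW _ _ (daha_rel q)). Qed.

Lemma daha_t_central i (x : daha hq) : GRing.comm (daha_t i + daha_tV i) x.
Proof.
rewrite /GRing.comm; elim/dclsW: x => x.
by rewrite -dclsD -!dclsM; apply/dcls_rel/DahaCentral.
Qed.

Lemma daha_tP : daha_data q daha_t daha_tV.
Proof.
split=> [i|i|i j|].
- by rewrite -dclsM -dcls1; apply/dcls_rel/DahaMulV.
- by rewrite -dclsM -dcls1; apply/dcls_rel/DahaVMul.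
- exact: daha_t_central.
- by have := dcls_rel (DahaProd q); rewrite !dclsM dclsS.
Qed.

End Instances.

Section Lift.
Variables (q : F) (hq : q != 0) (A : algType F) (u v : 'Z_4 -> A).
Hypothesis uvD : daha_data q u v.

Definition daha_lift of daha_data q u v : daha hq -> A :=
  @pres_lift _ _ (daha_rel q) A (daha_val u v).

Fact daha_lift_zmod : zmod_morphism (daha_lift uvD).
Proof.
move=> x y; rewrite -scaleN1r /daha_lift (pres_liftD (daha_respects uvD)).
by rewrite (pres_liftZ (daha_respects uvD)) scaleN1r.
Qed.
Fact daha_lift_monoid : monoid_morphism (daha_lift uvD).
Proof.
split; first exact: (pres_lift1 (daha_respects uvD)).
exact: (pres_liftM (daha_respects uvD)).
Qed.
Fact daha_lift_scalable : scalable (daha_lift uvD).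
Proof. exact: (pres_liftZ (daha_respects uvD)). Qed.

HB.instance Definition _ :=
  GRing.isZmodMorphism.Build (daha hq) A (daha_lift uvD) daha_lift_zmod.
HB.instance Definition _ :=
  GRing.isMonoidMorphism.Build (daha hq) A (daha_lift uvD) daha_lift_monoid.
HB.instance Definition _ :=
  GRing.isScalable.Build F (daha hq) A *:%R (daha_lift uvD) daha_lift_scalable.

Lemma daha_lift_t i : daha_lift uvD (daha_t hq i) = u i.
Proof. exact: (pres_liftE (daha_respects uvD)). Qed.
Lemma daha_lift_tV i : daha_lift uvD (daha_tV hq i) = v i.
Proof. exact: (pres_liftE (daha_respects uvD)). Qed.

End Lift.

Lemma daha_morph_ext (q : F) (hq : q != 0) (A : algType F)
    (f g : {lrmorphism daha hq -> A}) :
  (forall i, f (daha_t hq i) = g (daha_t hq i)) -> f =1 g.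
Proof.
move=> fg; have [tV Vt _ _] := daha_tP hq.
have fgV i : f (daha_tV hq i) = g (daha_tV hq i).
  have gtV : g (daha_t hq i) * g (daha_tV hq i) = 1.
    by rewrite -rmorphM tV rmorph1.
  have fVt : f (daha_tV hq i) * f (daha_t hq i) = 1.
    by rewrite -rmorphM Vt rmorph1.
  by rewrite -[LHS]mulr1 -gtV mulrA -fg fVt mul1r.
elim/dclsW; elim=> [[] i|a|x IHx y IHy|x IHx y IHy].
- exact: fg.
- exact: fgV.
- by rewrite dclsS !linearZ !rmorph1.
- by rewrite dclsD !raddfD /= IHx IHy.
- by rewrite dclsM !rmorphM /= IHx IHy.
Qed.

(* The action of Z/4Z on the algebra by t_i |-> t_(i + e). *)
Section Rotation.
Variables (q : F) (hq : q != 0).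

Lemma daha_rot_data (e : 'Z_4) :
  daha_data q (fun i => daha_t hq (i + e)) (fun i => daha_tV hq (i + e)).
Proof.
have [tV Vt tC tP] := daha_tP hq.
have rot (w x y z x' : daha hq) : x' * w = 1 ->
    w * x * y * z = q^-1%:A -> x * y * z * w = q^-1%:A.
  move=> xw wP; have -> : x * y * z * w = x' * (w * x * y * z) * w.
    by rewrite !mulrA xw mul1r.
  by rewrite wP mulr_algr -scalerAl xw.
have P1 := rot _ _ _ _ _ (Vt 0) tP.
have P2 := rot _ _ _ _ _ (Vt 1) P1.
have P3 := rot _ _ _ _ _ (Vt 2) P2.
split=> [i|i|i j|]; [exact: tV|exact: Vt|exact: tC|].
have E a b : a = b -> daha_t hq a = daha_t hq b by move->.
case: e => [[|[|[|[|//]]]]] he.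
- rewrite -[RHS]tP; congr (_ * _ * _ * _); apply: E; exact: val_inj.
- rewrite -[RHS]P1; congr (_ * _ * _ * _); apply: E; exact: val_inj.
- rewrite -[RHS]P2; congr (_ * _ * _ * _); apply: E; exact: val_inj.
- rewrite -[RHS]P3; congr (_ * _ * _ * _); apply: E; exact: val_inj.
Qed.

Definition daha_rot (e : 'Z_4) : {lrmorphism daha hq -> daha hq} :=
  daha_lift (daha_rot_data e).

Lemma daha_rotE e i : daha_rot e (daha_t hq i) = daha_t hq (i + e).
Proof. exact: daha_lift_t. Qed.

Lemma daha_rot0 : daha_rot 0 =1 id.
Proof.
apply: (@daha_morph_ext _ hq _ (daha_rot 0) idfun) => i.
by rewrite daha_rotE addr0.
Qed.

Lemma daha_rotD e e' : daha_rot (e + e') =1 daha_rot e \o daha_rot e'.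
Proof.
apply: (@daha_morph_ext _ hq _ (daha_rot (e + e'))
  (daha_rot e \o daha_rot e')) => i.
by rewrite /= !daha_rotE -addrA (addrC e).
Qed.

End Rotation.

(* Modules are left modules over the algebra; F acts through a |-> a%:A. *)
Section Modules.
Variables (q : F) (hq : q != 0).
Implicit Types U V W : lmodType (daha hq).

Definition has_dim V (n : nat) : Prop :=
  exists b : 'I_n -> V, forall x : V,
    exists! c : 'rV[F]_n, x = \sum_i ((c 0 i)%:A : daha hq) *: b i.

Definition irreducible V : Prop :=
  (exists x : V, x != 0) /\
  (forall S : {pred V}, submod_closed S ->
     (exists2 x, x \in S & x != 0) -> forall x, x \in S).

Definition isomorphic V W : Prop := exists f : {linear V -> W}, bijective f.

Lemma isomorphic_refl V : isomorphic V V.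
Proof. by exists idfun; exists idfun. Qed.

Lemma isomorphic_sym V W : isomorphic V W -> isomorphic W V.
Proof.
case=> f [g fK gK].
have g_lin : linear g.
  by move=> a x y; rewrite -{1}(gK x) -{1}(gK y) -linearP fK.
pose gM := GRing.isLinear.Build (daha hq) W V *:%R g g_lin.
pose gL : {linear W -> V} := HB.pack g gM.
by exists gL; exists f.
Qed.

Lemma isomorphic_trans U V W :
  isomorphic U V -> isomorphic V W -> isomorphic U W.
Proof.
by case=> f f_bij [g g_bij]; exists (g \o f); exact: bij_comp.
Qed.

(* A plain predicate, because [set (lmodType _)] is universe-inconsistent. *)
Definition iso_class V : lmodType (daha hq) -> Prop :=
  fun W => isomorphic V W.

Lemma iso_class_eq V W : iso_class V = iso_class W <-> isomorphic V W.
Proof.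
split=> [E|VW].
  by have : iso_class W W by [exact: isomorphic_refl]; rewrite -E.
apply/funext => U; apply/propext; split; apply: isomorphic_trans => //.
exact: isomorphic_sym.
Qed.

Definition EM_classes (d : nat) : Type :=
  {C : lmodType (daha hq) -> Prop |
    exists V, [/\ irreducible V, has_dim V d.+1 & C = iso_class V]}.

End Modules.

(* x acts on twist e V as daha_rot e x acts on V. *)
Section Twist.
Variables (q : F) (hq : q != 0) (e : 'Z_4) (V : lmodType (daha hq)).

Definition twisted : Type := V.
HB.instance Definition _ := GRing.Zmodule.on twisted.

Definition twist_scale (x : daha hq) (v : twisted) : twisted :=
  (daha_rot hq e x *: (v : V) : V).

Fact twist_scaleA x y v :
  twist_scale x (twist_scale y v) = twist_scale (x * y) v.
Proof. by rewrite /twist_scale rmorphM scalerA. Qed.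
Fact twist_scale1 : left_id 1 twist_scale.
Proof. by move=> v; rewrite /twist_scale rmorph1 scale1r. Qed.
Fact twist_scaleDr : right_distributive twist_scale +%R.
Proof. by move=> x u v; apply: scalerDr. Qed.
Fact twist_scaleDl v : {morph twist_scale^~ v : x y / x + y}.
Proof. by move=> x y; rewrite /twist_scale raddfD; apply: scalerDl. Qed.

HB.instance Definition _ := GRing.Zmodule_isLmodule.Build (daha hq) twisted
  twist_scaleA twist_scale1 twist_scaleDr twist_scaleDl.

Definition twist : lmodType (daha hq) := twisted.

End Twist.

Section RepModule.
Variables (q : F) (hq : q != 0) (n : nat).
Variable rho : {lrmorphism daha hq -> 'M[F]_n.+1}.

Definition rep_space : Type := 'cV[F]_n.+1.
HB.instance Definition _ := GRing.Zmodule.on rep_space.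

Definition rep_scale (x : daha hq) (v : rep_space) : rep_space := rho x *m v.

Fact rep_scaleA x y v : rep_scale x (rep_scale y v) = rep_scale (x * y) v.
Proof. by rewrite /rep_scale rmorphM mulmxA. Qed.
Fact rep_scale1 : left_id 1 rep_scale.
Proof. by move=> v; rewrite /rep_scale rmorph1 mul1mx. Qed.
Fact rep_scaleDr : right_distributive rep_scale +%R.
Proof. by move=> x u v; apply: mulmxDr. Qed.
Fact rep_scaleDl v : {morph rep_scale^~ v : x y / x + y}.
Proof. by move=> x y; rewrite /rep_scale raddfD; apply: mulmxDl. Qed.

HB.instance Definition _ := GRing.Zmodule_isLmodule.Build (daha hq) rep_space
  rep_scaleA rep_scale1 rep_scaleDr rep_scaleDl.

Definition rep_module : lmodType (daha hq) := rep_space.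

End RepModule.

End DAHA.

Section EModule.
Context {F : fieldType}.
Variables (q : F) (hq : q != 0) (d : nat).

Definition quad : Type := (F * F * F * F)%type.

Definition E_param (k : quad) : Prop :=
  let: (k0, k1, k2, k3) := k in
  [/\ k0 != 0, k1 != 0, k2 != 0, k3 != 0 & k0 ^+ 2 = q ^- d.+1].

Definition EP : quad -> Prop := fun k =>
  E_param k /\
  let: (k0, k1, k2, k3) := k in
  forall i : nat, odd i -> (i <= d)%N ->
    [/\ k0 * k1 * k2 * k3 != q ^- i, k0 * k1^-1 * k2 * k3 != q ^- i,
        k0 * k1 * k2^-1 * k3 != q ^- i & k0 * k1 * k2 * k3^-1 != q ^- i].

Section Matrices.
Variables k0 k1 k2 k3 : F.

(* The basis vector v_i; inord makes the value meaningless for i > d. *)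
Definition Ev (i : nat) : 'cV[F]_d.+1 := delta_mx (inord i) 0.

(* E_t0 i, ..., E_t3 i are the vectors t_0 v_i, ..., t_3 v_i. *)
Definition E_t0 (i : nat) : 'cV[F]_d.+1 :=
  if i == 0%N then k0 *: Ev 0
  else if i == d then k0 *: Ev d
  else if odd i then (k0^-1 * q ^- i.+1) *: (Ev i - Ev i.+1)
  else (k0^-1 * q ^- i * (1 - q ^+ i) * (1 - k0 ^+ 2 * q ^+ i)) *: Ev i.-1
       + (k0 + k0^-1 - k0^-1 * q ^- i) *: Ev i.

Definition E_t1 (i : nat) : 'cV[F]_d.+1 :=
  if i == 0%N then k1 *: Ev 0 + k1^-1 *: Ev 1
  else if odd i then k1^-1 *: Ev i
  else - (k1 * (1 - q ^+ i) * (1 - k0 ^+ 2 * q ^+ i)) *: Ev i.-1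
       + k1 *: Ev i + k1^-1 *: Ev i.+1.

Definition E_t2 (i : nat) : 'cV[F]_d.+1 :=
  if odd i then
    ((k0 * k1 * k3 * q ^+ i - k2) * (k0 * k1 * k3 * q ^+ i - k2^-1)
       / (k0 * k1 * k3 * q ^+ i)) *: Ev i.-1
    + (k2 + k2^-1 - k0^-1 * k1^-1 * k3^-1 * q ^- i) *: Ev i
  else (k0^-1 * k1^-1 * k3^-1 * q ^- i.+1) *: (Ev i - Ev i.+1).

Definition E_t3 (i : nat) : 'cV[F]_d.+1 :=
  if odd i then
    - (k3^-1 * (k0 * k1 * k3 * q ^+ i - k2)
             * (k0 * k1 * k3 * q ^+ i - k2^-1)) *: Ev i.-1
    + k3^-1 *: Ev i + (if i == d then 0 else k3 *: Ev i.+1)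
  else k3 *: Ev i.

Definition E_op (c : nat -> 'cV[F]_d.+1) : 'M[F]_d.+1 := \matrix_(m, i) c i m 0.

Lemma E_opE c i : (i <= d)%N -> E_op c *m Ev i = c i.
Proof.
move=> id; rewrite /Ev -colE; apply/colP => m; rewrite !mxE.
by rewrite inordK.
Qed.

Lemma E_mx_ext (A B : 'M[F]_d.+1) :
  (forall i, (i <= d)%N -> A *m Ev i = B *m Ev i) -> A = B.
Proof.
move=> h; apply/matrixP => m i; have := h i (leq_ord i).
by rewrite /Ev -!colE inord_val => /colP /(_ m); rewrite !mxE.
Qed.

Definition E_t (j : 'Z_4) : 'M[F]_d.+1 :=
  E_op (match val j with 0 => E_t0 | 1 => E_t1 | 2 => E_t2 | _ => E_t3 end).

Definition E_s (j : 'Z_4) : F :=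
  match val j with
  | 0 => k0 + k0^-1 | 1 => k1 + k1^-1 | 2 => k2 + k2^-1 | _ => k3 + k3^-1
  end.

Definition E_tV (j : 'Z_4) : 'M[F]_d.+1 := (E_s j)%:M - E_t j.

Hypothesis hd : odd d.
Hypothesis hk : E_param (k0, k1, k2, k3).

Let A0 := E_op E_t0.
Let A1 := E_op E_t1.
Let A2 := E_op E_t2.
Let A3 := E_op E_t3.

Fact A0_even i : ~~ odd i -> (i <= d)%N -> A0 *m Ev i =
  (k0^-1 * q ^- i * (1 - q ^+ i) * (1 - k0 ^+ 2 * q ^+ i)) *: Ev i.-1
  + (k0 + k0^-1 - k0^-1 * q ^- i) *: Ev i.
Proof.
move=> oi id; rewrite /A0 E_opE // /E_t0 (negbTE oi).
case: (altP (i =P 0%N)) => [->|i0].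
  by rewrite expr0 subrr !(mulr0, mul0r) scale0r add0r invr1 mulr1 addrK.
by case: (altP (i =P d)) => // iD; move: oi; rewrite iD hd.
Qed.

Fact A0_odd i : odd i -> (i < d)%N -> A0 *m Ev i =
  (k0^-1 * q ^- i.+1) *: (Ev i - Ev i.+1).
Proof.
move=> oi id; rewrite /A0 E_opE 1?ltnW // /E_t0 oi (ltn_eqF id).
by case: eqP oi => // ->.
Qed.

Fact A0_d : A0 *m Ev d = k0 *: Ev d.
Proof.
rewrite /A0 E_opE // /E_t0 eqxx; case: ifP => // /eqP d0.
by exfalso; move: hd; rewrite d0.
Qed.

Fact A1_0 : A1 *m Ev 0 = k1 *: Ev 0 + k1^-1 *: Ev 1.
Proof. by rewrite /A1 E_opE. Qed.

Fact A1_even i : ~~ odd i -> (i <= d)%N -> A1 *m Ev i =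
  - (k1 * (1 - q ^+ i) * (1 - k0 ^+ 2 * q ^+ i)) *: Ev i.-1
  + k1 *: Ev i + k1^-1 *: Ev i.+1.
Proof.
move=> oi id; rewrite /A1 E_opE // /E_t1 (negbTE oi).
case: eqP => // ->.
by rewrite expr0 subrr !(mulr0, mul0r) oppr0 scale0r add0r.
Qed.

Fact A1_odd i : odd i -> (i <= d)%N -> A1 *m Ev i = k1^-1 *: Ev i.
Proof.
by move=> oi id; rewrite /A1 E_opE // /E_t1 oi; case: eqP oi => // ->.
Qed.

Fact A2_even i : ~~ odd i -> (i <= d)%N -> A2 *m Ev i =
  (k0^-1 * k1^-1 * k3^-1 * q ^- i.+1) *: (Ev i - Ev i.+1).
Proof. by move=> oi id; rewrite /A2 E_opE // /E_t2 (negbTE oi). Qed.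

Fact A2_odd i : odd i -> (i <= d)%N -> A2 *m Ev i =
  ((k0 * k1 * k3 * q ^+ i - k2) * (k0 * k1 * k3 * q ^+ i - k2^-1)
     / (k0 * k1 * k3 * q ^+ i)) *: Ev i.-1
  + (k2 + k2^-1 - k0^-1 * k1^-1 * k3^-1 * q ^- i) *: Ev i.
Proof. by move=> oi id; rewrite /A2 E_opE // /E_t2 oi. Qed.

Fact A3_even i : ~~ odd i -> (i <= d)%N -> A3 *m Ev i = k3 *: Ev i.
Proof. by move=> oi id; rewrite /A3 E_opE // /E_t3 (negbTE oi). Qed.

Fact A3_odd i : odd i -> (i <= d)%N -> A3 *m Ev i =
  - (k3^-1 * (k0 * k1 * k3 * q ^+ i - k2)
           * (k0 * k1 * k3 * q ^+ i - k2^-1)) *: Ev i.-1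
  + k3^-1 *: Ev i + (if i == d then 0 else k3 *: Ev i.+1).
Proof. by move=> oi id; rewrite /A3 E_opE // /E_t3 oi. Qed.

(* A vector index i <= d is even, or of the form j.+1 with j even. *)
Fact even_or_odd (P : nat -> Prop) :
  (forall i, ~~ odd i -> (i.+1 <= d)%N -> P i /\ P i.+1) ->
  forall i, (i <= d)%N -> P i.
Proof.
move=> h i id; case oi : (odd i).
  case: i oi id => // i /= oi id; exact: (h i oi id).2.
have : (i < d)%N.
  by rewrite ltn_neqAle id andbT; apply: contraFN oi => /eqP ->.
by move=> id'; apply: (h i _ id').1; rewrite oi.
Qed.

Let k0n : k0 != 0. Proof. by case: hk. Qed.
Let k1n : k1 != 0. Proof. by case: hk. Qed.
Let k2n : k2 != 0. Proof. by case: hk. Qed.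
Let k3n : k3 != 0. Proof. by case: hk. Qed.
Let k0q : k0 ^+ 2 * q ^+ d.+1 = 1.
Proof. by case: hk => _ _ _ _ ->; rewrite mulVf // expf_neq0. Qed.

Local Ltac lin :=
  rewrite ?(mulmxDr, mulmxBr, mulmxN, mulmx0, =^~ scalemxAr).
Local Ltac ent :=
  repeat match goal with |- context [Ev ?i] =>
    let x := fresh "x" in move: (Ev i) => x end;
  apply/colP => ?; rewrite !mxE /=.

Fact E_quad0 i : (i <= d)%N ->
  A0 *m (A0 *m Ev i) = (k0 + k0^-1) *: (A0 *m Ev i) - Ev i.
Proof.
move: i; apply: even_or_odd => i oi id; split.
  case: i oi id => [|[//|i]] oi id.
    rewrite (A0_even oi) 1?ltnW // expr0 subrr !(mulr0, mul0r) scale0r add0r.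
    rewrite invr1 mulr1 addrK -scalemxAr (A0_even oi) 1?ltnW //.
    rewrite expr0 subrr !(mulr0, mul0r) scale0r add0r.
    by rewrite invr1 mulr1 addrK; ent; field.
  have o' : odd i.+1 by rewrite -[odd _]negbK.
  have id' : (i.+2 <= d)%N by rewrite ltnW.
  rewrite (A0_even oi id') /=; lin; rewrite (A0_even oi id') (A0_odd o') //=.
  have qi : q ^+ i != 0 by rewrite expf_neq0.
  rewrite !exprS; ent; field.
  by rewrite k0n hq qi.
have o1 : odd i.+1 by [].
case: (altP (i.+1 =P d)) => [->|iD].
  by rewrite A0_d -scalemxAr A0_d; ent; field.
have id2 : (i.+1 < d)%N by rewrite ltn_neqAle iD.
have o2 : ~~ odd i.+2 by rewrite /= negbK.
rewrite A0_odd //; lin; rewrite A0_odd // (A0_even o2 id2) /=.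
have qi : q ^+ i != 0 by rewrite expf_neq0.
rewrite !exprS; ent; field.
by rewrite k0n hq qi.
Qed.

Fact E_quad1 i : (i <= d)%N ->
  A1 *m (A1 *m Ev i) = (k1 + k1^-1) *: (A1 *m Ev i) - Ev i.
Proof.
move: i; apply: even_or_odd => i oi id; split; last first.
  by rewrite A1_odd //; lin; rewrite A1_odd //; ent; field.
have o1 : odd i.+1 by [].
case: i oi id o1 => [|[//|i]] oi id o1.
  by rewrite A1_0; lin; rewrite A1_0 A1_odd //; ent; field.
have o' : odd i.+1 by rewrite -[odd _]negbK.
have id' : (i.+2 <= d)%N by rewrite ltnW.
rewrite (A1_even oi id') /=; lin; rewrite (A1_even oi id') /=.
rewrite (A1_odd o1 id) (A1_odd o') 1?ltnW 1?ltnW //=.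
by rewrite !exprS; ent; field.
Qed.

Fact E_quad2 i : (i <= d)%N ->
  A2 *m (A2 *m Ev i) = (k2 + k2^-1) *: (A2 *m Ev i) - Ev i.
Proof.
move: i; apply: even_or_odd => i oi id.
have o1 : odd i.+1 by [].
have id' : (i <= d)%N by rewrite ltnW.
have qi : q ^+ i != 0 by rewrite expf_neq0.
split.
  rewrite (A2_even oi id'); lin; rewrite (A2_even oi id') A2_odd //=.
  rewrite !exprS; ent; field.
  by rewrite k0n k1n k2n k3n hq qi.
rewrite (A2_odd o1 id) /=; lin; rewrite (A2_even oi id') A2_odd //=.
rewrite !exprS; ent; field.
by rewrite k0n k1n k2n k3n hq qi.
Qed.

Fact E_quad3 i : (i <= d)%N ->
  A3 *m (A3 *m Ev i) = (k3 + k3^-1) *: (A3 *m Ev i) - Ev i.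
Proof.
move: i; apply: even_or_odd => i oi id; split.
  by rewrite A3_even 1?ltnW //; lin; rewrite A3_even 1?ltnW //; ent; field.
have o1 : odd i.+1 by [].
rewrite (A3_odd o1 id) /=; case: (altP (i.+1 =P d)) => iD.
  lin; rewrite (A3_odd o1 id) (A3_even oi) 1?ltnW //= (introT eqP iD).
  by rewrite !exprS; ent; field; rewrite k2n k3n.
have id2 : (i.+2 <= d)%N by rewrite ltn_neqAle iD.
have o2 : ~~ odd i.+2 by rewrite /= negbK.
lin; rewrite (A3_odd o1 id) (A3_even oi) 1?ltnW //= (A3_even o2 id2) (negbTE iD).
by rewrite !exprS; ent; field; rewrite k2n k3n.
Qed.

Fact E_012 i : ~~ odd i -> (i.+1 <= d)%N ->
  A0 *m (A1 *m (A2 *m Ev i)) = (k3^-1 * q^-1) *: Ev i.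
Proof.
move=> oi id; have id' : (i <= d)%N by rewrite ltnW.
have o1 : odd i.+1 by [].
have qi : q ^+ i != 0 by rewrite expf_neq0.
have -> : A1 *m (A2 *m Ev i) = (k0^-1 * k1^-1 * k3^-1 * q ^- i.+1) *:
    (- (k1 * (1 - q ^+ i) * (1 - k0 ^+ 2 * q ^+ i)) *: Ev i.-1 + k1 *: Ev i).
  rewrite (A2_even oi id'); lin; rewrite (A1_even oi id') (A1_odd o1 id).
  by rewrite addrK.
case: i oi id id' o1 qi => [|[//|i]] oi id id' o1 qi.
  rewrite !expr0 subrr !(mulr0, mul0r) oppr0 scale0r add0r; lin.
  rewrite A0_even // expr0 subrr !(mulr0, mul0r) scale0r add0r.
  by rewrite expr1; ent; field; rewrite k0n k1n k3n hq oner_neq0.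
have o' : odd i.+1 by rewrite -[odd _]negbK.
lin; rewrite (A0_even oi id') (A0_odd o') //=.
have qi' : q ^+ i != 0 by rewrite expf_neq0.
by rewrite !exprS; ent; field; rewrite k0n k1n k3n hq qi'.
Qed.

Fact E_01 i : ~~ odd i -> (i.+1 <= d)%N ->
  A0 *m (A1 *m Ev i) =
  A0 *m (A1 *m Ev i.+1) + (k0 * k1 * q ^+ i) *: Ev i.
Proof.
move=> oi id; have id' : (i <= d)%N by rewrite ltnW.
have qi : q ^+ i != 0 by rewrite expf_neq0.
set c := k0^-1 * k1^-1 * k3^-1 * q ^- i.+1.
have cn : c != 0 by rewrite !mulf_neq0 ?invr_eq0 // expf_neq0.
have := E_012 oi id; rewrite (A2_even oi id') -/c; lin => E.
rewrite -[LHS](subrK (A0 *m (A1 *m Ev i.+1))) addrC; congr (_ + _).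
apply: (scalerI cn); rewrite E scalerA /c !exprS; congr (_ *: _).
by field; rewrite k0n k1n k3n hq qi.
Qed.

Fact E_prod i : (i <= d)%N ->
  A0 *m (A1 *m (A2 *m (A3 *m Ev i))) = q^-1 *: Ev i.
Proof.
move: i; apply: even_or_odd => i oi id.
have id' : (i <= d)%N by rewrite ltnW.
have o1 : odd i.+1 by [].
have qi : q ^+ i != 0 by rewrite expf_neq0.
split.
  by rewrite A3_even //; lin; rewrite E_012 //; ent; field; rewrite k3n hq.
rewrite (A3_odd o1 id) /=; case: (altP (i.+1 =P d)) => iD.
  rewrite addr0; lin; rewrite E_012 // A2_odd //=; lin; rewrite E_01 //.
  rewrite A1_odd //; lin.
  have -> : A0 *m Ev i.+1 = k0 *: Ev i.+1 by rewrite iD A0_d.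
  have k0q' : q ^+ i = (k0 ^+ 2 * q ^+ 2)^-1.
    apply: (mulfI (_ : k0 ^+ 2 * q ^+ 2 != 0)).
      by rewrite mulf_neq0 // expf_neq0.
    rewrite mulfV ?mulf_neq0 ?expf_neq0 // -mulrA -exprD add2n.
    by rewrite -[RHS]k0q -iD.
  rewrite !exprS k0q'; ent; field.
  by rewrite k0n k1n k2n k3n hq oner_neq0.
have id2 : (i.+2 < d)%N.
  have id2 : (i.+2 <= d)%N by rewrite ltn_neqAle iD.
  rewrite ltn_neqAle id2 andbT; apply/eqP => e.
  by have := congr1 odd e; rewrite hd /= negbK (negbTE oi).
have o2 : ~~ odd i.+2 by rewrite /= negbK.
lin; rewrite (E_012 oi id) (E_012 o2 id2) A2_odd //=; lin.
rewrite E_01 // A1_odd //; lin; rewrite A0_odd 1?ltnW //.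
rewrite !exprS; ent; field.
by rewrite k0n k1n k2n k3n hq qi.
Qed.

Lemma E_data : daha_data q E_t E_tV.
Proof.
have quad j : E_t j *m E_t j = E_s j *: E_t j - 1%:M.
  apply: E_mx_ext => i id; rewrite -mulmxA mulmxBl -scalemxAl mul1mx.
  case: j => [[|[|[|[|//]]]]] ?.
  - exact: E_quad0.
  - exact: E_quad1.
  - exact: E_quad2.
  - exact: E_quad3.
split=> [j|j|j l|].
- rewrite /E_tV -mulmxE mulmxBr quad scalar_mxC mul_scalar_mx.
  by rewrite opprB addrC subrK.
- rewrite /E_tV -mulmxE mulmxBl quad mul_scalar_mx.
  by rewrite opprB addrC subrK.
- by rewrite /E_tV addrC subrK /GRing.comm -mulmxE -scalar_mxC.
- apply: E_mx_ext => i id; rewrite -!mulmxE -!mulmxA -scalemxAl mul1mx.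
  exact: E_prod.
Qed.

End Matrices.

Definition E_module (hd : odd d) (k : quad) : E_param k -> lmodType (daha hq) :=
  let: (k0, k1, k2, k3) := k in
  fun hk => rep_module (daha_lift (hq := hq) (E_data hd hk)).

Lemma E_moduleE (hd : odd d) k0 k1 k2 k3 (hk : E_param (k0, k1, k2, k3))
    (j : 'Z_4) (v : 'cV[F]_d.+1) :
  daha_t hq j *: (v : E_module hd hk) = E_t k0 k1 k2 k3 j *m v.
Proof. by rewrite -(daha_lift_t hq (E_data hd hk)). Qed.

(* {1, -1}^3 is encoded by triples of booleans, true standing for -1. *)
Definition sign_act (k : quad) (s : bool * bool * bool) : quad :=
  let: (k0, k1, k2, k3) := k in
  let: (s1, s2, s3) := s in
  (k0, (if s1 then k1^-1 else k1), (if s2 then k2^-1 else k2),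
   (if s3 then k3^-1 else k3)).

Lemma sign_act1 k : sign_act k (false, false, false) = k.
Proof. by case: k => [[[]]]. Qed.

Lemma sign_actM k s1 s2 s3 r1 r2 r3 :
  sign_act (sign_act k (s1, s2, s3)) (r1, r2, r3) =
  sign_act k (s1 (+) r1, s2 (+) r2, s3 (+) r3).
Proof.
case: k => [[[k0 k1] k2] k3].
by case: s1 s2 s3 r1 r2 r3 => [] [] [] [] [] [] /=; rewrite ?invrK.
Qed.

Lemma sign_act_EP (hd : odd d) k s : EP k -> EP (sign_act k s).
Proof.
have step0 k0 k1 k2 k3 : EP (k0, k1, k2, k3) -> EP (k0, k2, k1, k3).
  move=> [[? ? ? ? ?] h]; split=> // i oi id; have [? ? ? ?] := h i oi id.
  by split; rewrite (mulrAC k0).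
have step1 k0 k1 k2 k3 : EP (k0, k1, k2, k3) -> EP (k0, k3, k2, k1).
  move=> [[? ? ? ? ?] h]; split=> // i oi id; have [? ? ? ?] := h i oi id.
  by split; rewrite mulrAC (mulrAC k0) mulrAC.
have step k0 k1 k2 k3 : EP (k0, k1, k2, k3) -> EP (k0, k1^-1, k2, k3).
  move=> [[k0n k1n k2n k3n k0q] h]; split; first by split; rewrite ?invr_eq0.
  move=> i oi id; have [h1 h2 h3 h4] := h i oi id.
  have id' : (d.+1 - i <= d)%N.
    by case: i oi {id h1 h2 h3 h4} => // i _; exact: leq_subr.
  have oi' : odd (d.+1 - i) by rewrite oddB ?leqW //= hd oi.
  have [g1 g2 g3 g4] := h _ oi' id'.
  have qd : q ^- d.+1 = q ^- i * q ^- (d.+1 - i).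
    by rewrite -invfM -exprD subnKC // leqW.
  have key x y : x * y = k0 ^+ 2 -> x != q ^- (d.+1 - i) -> y != q ^- i.
    move=> xy; apply: contraNN => /eqP yq.
    have qi : q ^- i != 0 by rewrite invr_eq0 expf_neq0.
    by apply/eqP/(mulIf qi); rewrite [RHS]mulrC -qd -k0q -xy yq.
  rewrite invrK; split=> //.
  - by apply: (key _ _ _ g4); field; rewrite k1n k2n k3n.
  - by apply: (key _ _ _ g3); field; rewrite k1n k2n k3n.
case: k s => [[[k0 k1] k2] k3] [[s1 s2] s3] h /=.
have {}h : EP (k0, (if s1 then k1^-1 else k1), k2, k3).
  by case: s1 => //; exact: step.
have {}h : EP (k0, (if s1 then k1^-1 else k1),
    (if s2 then k2^-1 else k2), k3).
  by case: s2 => //; apply/step0/step/step0.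
by case: s3 => //; apply/step1/step/step1.
Qed.

Definition sign_orbit (k : quad) : quad -> Prop :=
  fun k' => exists s, k' = sign_act k s.

Definition EP_orbits : Type :=
  {O : quad -> Prop | exists k, EP k /\ O = sign_orbit k}.

Definition EP_orbit (k : quad) (hk : EP k) : EP_orbits :=
  exist _ (sign_orbit k) (ex_intro _ k (conj hk erefl)).

End EModule.

(* Main.v *)
From HB Require Import structures.
Require Import Defs.
From mathcomp Require Import all_boot all_order all_algebra.
From mathcomp Require Import zify ring.
From mathcomp Require Import boolp.

Set Implicit Arguments.
Unset Strict Implicit.
Unset Printing Implicit Defensive.

Import GRing.Theory.
Local Open Scope ring_scope.

(** Let n be the dimension of an irreducible module. By Schur's lemma each
    t_i + t_i^-1 acts as a scalar k_i + k_i^-1, so the module amounts to four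
    matrices T_i with (T_i - k_i)(T_i - k_i^-1) = 0 and T_0 T_1 T_2 T_3 = q^-1
    that have no common invariant subspace. Let r_i be the rank of T_i - k_i,
    where k_i is replaced by its inverse if necessary, so that 2 r_i <= n.

    Rigidity. Scott's argument, applied to the T_i acting by conjugation on
    n x n matrices, bounds the sum of the ranks of A |-> [T_i, A] from below by
    2 (n^2 - 1), since only scalars commute with all the T_i
    ([scott_inequality]); each of these ranks is at most 2 r_i (n - r_i)
    ([hecke_commutator_rank]). Hence the sum of the (n - 2 r_i)^2 is at most 4.
    Comparing determinants, the product of the k_i^(n - 2 r_i) is q^-n. As q is
    not a root of unity, for even n there is exactly one index j with
    n - 2 r_j = 2, and k_j^2 = q^-n ([irr_even]); for odd n all the n - 2 r_i
    are 1 and the product of the k_i is q^-n ([irr_odd]).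

    Surjectivity. Let n = d + 1, and twist so that j = 0. The kernels of
    T_0 - k_0 and T_3 - k_3 have dimensions n/2 + 1 and n/2, so they share a
    vector v_0. The relations alone force the vectors v_1, v_2, ... generated
    from v_0 to satisfy the formulas that define E ([chain_rel]), and
    irreducibility makes v_0, ..., v_d a basis. If v_(d+1) were nonzero, the
    chain that starts from it would show that T_0 - k_0 has rank at least n/2;
    so v_(d+1) = 0 and the module is E(k_0, k_1, k_2, k_3) ([irr_iso_E]). Here
    k_1, k_2, k_3 may each be inverted, so E depends only on the orbit.

    The parameters. In E the rank of T_0 - k_0 is less than n/2, hence some
    composition factor, of dimension m say, inherits this property. Rigidity
    gives k_0^2 = q^-m if m is even, so that m = n, and a relation excluded by
    the conditions on the parameters if m is odd. These conditions thus make E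
    irreducible ([EP_irr]). Conversely, if one of them fails then, for suitable
    signs, the coefficient of v_(i-1) in t_2 v_i vanishes for some odd i and
    v_i, ..., v_d span a submodule ([irr_EP]).

    Injectivity. The twist is recovered from the unique exceptional index, and
    k_i up to inversion from the scalar k_i + k_i^-1; k_0 cannot be inverted
    because k_0^2 = q^-n ([E_twist_inj]). *)

(** * The quadratic relation of a single generator *)

Section Quadratic.
Variable F : fieldType.

Definition hecke (k : F) n (T : 'M[F]_n) : Prop :=
  T *m T = (k + k^-1) *: T - 1%:M.

Lemma heckeV k n (T : 'M[F]_n) : hecke k T -> hecke k^-1 T.
Proof. by rewrite /hecke invrK (addrC k^-1). Qed.

Lemma hecke_factor k n (T : 'M[F]_n) : k != 0 -> hecke k T ->
  (T - k%:M) *m (T - k^-1%:M) = 0.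
Proof.
move=> k0 h; rewrite mulmxBl !mulmxBr h -scalar_mxM mulfV //.
rewrite mul_scalar_mx mul_mx_scalar.
apply/matrixP => i j; rewrite !mxE.
by case: (i == j); rewrite ?mulr1n ?mulr0n; ring.
Qed.

(** Under [hecke k T] with k <> k^-1 this is the multiplicity of the eigenvalue
    k^-1; the rank is the right substitute when k = k^-1 and T is perhaps not
    diagonalizable. *)
Definition hrank (k : F) n (T : 'M[F]_n) : nat := \rank (T - k%:M).

Lemma hecke_rankV k n (T : 'M[F]_n) : k != 0 -> hecke k T ->
  (hrank k T + hrank k^-1 T <= n)%N.
Proof. by move=> k0 h; apply/mulmx0_rank_max/hecke_factor. Qed.

Lemma hecke_rank_flip k n (T : 'M[F]_n) : k != 0 -> hecke k T ->
  (n < 2 * hrank k T)%N -> (2 * hrank k^-1 T <= n)%N.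
Proof. by move=> k0 h; have := hecke_rankV k0 h; lia. Qed.

(** Sylvester's determinant identity, from the two triangular factorizations of
    the block matrix with rows (k, B) and (-C, 1). *)
Lemma det_scalar_addM n r (k : F) (B : 'M[F]_(n, r)) (C : 'M[F]_(r, n)) :
  k != 0 -> \det (k%:M + B *m C) = k ^+ n * \det (1%:M + k^-1 *: (C *m B)).
Proof.
move=> k0; pose M := block_mx k%:M B (- C) 1%:M.
have E1 : M = block_mx 1%:M B 0 1%:M *m block_mx (k%:M + B *m C) 0 (- C) 1%:M.
  rewrite /M mulmx_block !(mul0mx, mulmx0, mul1mx, mulmx1, add0r, addr0).
  by rewrite mulmxN addrK.
have E2 : M = block_mx 1%:M 0 (- k^-1 *: C) 1%:M
    *m block_mx k%:M B 0 (1%:M + k^-1 *: (C *m B)).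
  rewrite /M mulmx_block !(mul0mx, mulmx0, mul1mx, mulmx1, add0r, addr0).
  rewrite mul_mx_scalar scalerA mulrN mulfV // scaleN1r -scalemxAl.
  by rewrite scaleNr addrCA addNr addr0.
have := congr1 determinant E1; rewrite [in LHS]E2 !det_mulmx.
by rewrite !det_ublock !det_lblock !det1 det_scalar !mul1r !mulr1 => ->.
Qed.

(** A rank factorization of T - k turns the quadratic relation into the
    statement that C B is scalar, uniformly in whether T is diagonalizable. *)
Lemma hecke_split k n (T : 'M[F]_n) : k != 0 -> hecke k T ->
  exists B : 'M[F]_(n, hrank k T), exists C : 'M[F]_(hrank k T, n),
  exists B', exists C',
  [/\ T = k%:M + B *m C, B' *m B = 1%:M, C *m C' = 1%:M
    & C *m B = (k^-1 - k)%:M].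
Proof.
move=> k0 h; have := hecke_factor k0 h; rewrite /hrank.
have -> : T - k^-1%:M = T - k%:M - (k^-1 - k)%:M.
  by rewrite raddfB /= opprB addrA subrK.
have: T = k%:M + (T - k%:M) by rewrite addrC subrK.
move: (T - k%:M) => N TN.
rewrite mulmxBr mul_mx_scalar => /subr0_eq NN.
have [C' CC'] : exists C', row_base N *m C' = 1%:M.
  by apply/row_freeP/row_base_free.
have [B' BB'] : exists B', B' *m col_base N = 1%:M.
  by apply/row_fullP/col_base_full.
exists (col_base N), (row_base N), B', C'; rewrite mulmx_base; split=> //.
have: col_base N *m row_base N *m (col_base N *m row_base N) =
  (k^-1 - k) *: (col_base N *m row_base N) by rewrite mulmx_base.
move: (col_base N) (row_base N) B' C' BB' CC'.
move: (\rank N) => r B C B' C' BB' CC' {}NN.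
have <- : B' *m (B *m C *m (B *m C)) *m C' = C *m B.
  by rewrite !mulmxA BB' mul1mx -!mulmxA CC' mulmx1.
by rewrite NN -scalemxAr -scalemxAl mulmxA BB' mul1mx CC' scalemx1.
Qed.

(** The determinant is k^(n - r) (k^-1)^r, with r the rank of T - k. *)
Lemma hecke_det k n (T : 'M[F]_n) : k != 0 -> hecke k T ->
  \det T * k ^+ (2 * hrank k T) = k ^+ n.
Proof.
move=> k0 /(hecke_split k0); move: (hrank k T) => r [B [C [_ [_ [-> _ _ CB]]]]].
rewrite det_scalar_addM // CB scale_scalar_mx -raddfD /=.
rewrite det_scalar mulrBr mulVf // addrC subrK -invfM -mulrA exprM.
by rewrite -exprMn mulVf ?mulf_neq0 // expr1n mulr1.
Qed.

Definition ad_mx n (T : 'M[F]_n) : 'M[F]_(n * n) := lin_mulmx T - lin_mulmxr T.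

Lemma mul_vec_ad n (T A : 'M[F]_n) :
  mxvec A *m ad_mx T = mxvec (T *m A - A *m T).
Proof. by rewrite mulmxBr !mul_vec_lin /= raddfB. Qed.

(** Write T = k + B C with inner dimension r. Then [T, A] = B U - W C, where
    U = C A and W = A B satisfy U B = C W. The pairs (U, W) with
    U B = C W form a space of dimension 2 r n - r^2, on which B U - W C vanishes
    at the r^2-dimensional family U = Z C, W = B Z, because C B is scalar. *)
Lemma hecke_commutator_rank k n (T : 'M[F]_n) : k != 0 -> hecke k T ->
  (\rank (ad_mx T) <= 2 * (hrank k T * (n - hrank k T)))%N.
Proof.
move=> k0 h; have rn : (hrank k T <= n)%N by exact: rank_leq_row.
have := hecke_split k0 h; move: (hrank k T) rn.
move=> r rn [B [C [B' [C' [TE BB' CC' CB]]]]].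
(* On encoded matrices: A |-> (C A, A B), (U, W) |-> U B - C W,
   (U, W) |-> B U - W C and Z |-> (Z C, B Z). *)
pose al : 'M_(n * n, r * n + n * r) := row_mx (lin_mulmx C) (lin_mulmxr B).
pose ga : 'M_(r * n + n * r, r * r) := col_mx (lin_mulmxr B) (- lin_mulmx C).
pose be : 'M_(r * n + n * r, n * n) := col_mx (lin_mulmx B) (- lin_mulmxr C).
pose ze : 'M_(r * r, r * n + n * r) := row_mx (lin_mulmxr C) (lin_mulmx B).
have ext m1 n1 p (X Y : 'M[F]_(m1 * n1, p)) :
    (forall A, mxvec A *m X = mxvec A *m Y) -> X = Y.
  by move=> E; apply/row_matrixP => i; rewrite !rowE -[delta_mx _ _]vec_mxK E.
have alga : al *m ga = 0.
  apply: ext => A; rewrite mulmxA mul_mx_row mul_row_col mulmxN !mul_vec_lin /=.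
  by rewrite mulmxA subrr mulmx0.
have zega : ze *m ga = 0.
  apply: ext => A; rewrite mulmxA mul_mx_row mul_row_col mulmxN !mul_vec_lin /=.
  by rewrite mulmxA -mulmxA CB scalar_mxC subrr mulmx0.
have zebe : ze *m be = 0.
  apply: ext => A; rewrite mulmxA mul_mx_row mul_row_col mulmxN !mul_vec_lin /=.
  by rewrite mulmxA subrr mulmx0.
have -> : ad_mx T = al *m be.
  apply: ext => A; rewrite mulmxA mul_mx_row mul_row_col mulmxN mul_vec_ad.
  rewrite !mul_vec_lin /= -raddfB /= TE mulmxDl mulmxDr scalar_mxC.
  by rewrite opprD addrACA subrr add0r !mulmxA.
have ra_ga : \rank ga = (r * r)%N.
  apply/eqP; rewrite -[_ == _]/(row_full _); apply/row_fullP.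
  exists (row_mx 0 (- lin_mulmx C')).
  apply: ext => A; rewrite mulmxA mul_mx_row mul_row_col mulmx0 mul0mx add0r.
  by rewrite !mulmxN mulNmx opprK !mul_vec_lin /= mulmxA CC' mul1mx mulmx1.
have ra_ze : \rank ze = (r * r)%N.
  apply/eqP; rewrite -[_ == _]/(row_free _); apply/row_freeP.
  exists (col_mx (lin_mulmxr C') 0).
  apply: ext => A; rewrite mulmxA mul_mx_row mul_row_col mulmx0 addr0.
  by rewrite !mul_vec_lin /= -mulmxA CC' !mulmx1.
have le1 : (\rank (al *m be) <= \rank (kermx ga *m be))%N.
  by apply/mxrankS/submxMr/sub_kermxP.
have le2 : (r * r <= \rank (kermx ga :&: kermx be))%N.
  apply: (@leq_trans (\rank ze)); first by rewrite ra_ze.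
  by apply: mxrankS; rewrite sub_capmx; apply/andP; split; apply/sub_kermxP.
have := mxrank_mul_ker (kermx ga) be; rewrite mxrank_ker ra_ga.
move: le1 le2; nia.
Qed.

End Quadratic.

(** * Rigidity of irreducible quadruples *)

Section Irreducible.
Variable F : closedFieldType.

(** The columns of K span a subspace, and T i *m K = K *m S says that it is
    invariant. Only the T i are required to preserve it: under the quadratic
    relations their inverses then preserve it as well. *)
Definition mx_irr n (T : 'Z_4 -> 'M[F]_n) : Prop :=
  (0 < n)%N /\ forall m (K : 'M[F]_(n, m)),
  (forall i, exists S, T i *m K = K *m S) -> K = 0 \/ row_free K.

(** The T i give a representation of the algebra in which t_i + t_i^-1 acts as
    the scalar k_i + k_i^-1; each k_i matters only up to inversion. *)
Definition daha_mx (q : F) (k : 'Z_4 -> F) n (T : 'Z_4 -> 'M[F]_n) : Prop :=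
  [/\ forall i, k i != 0, forall i, hecke (k i) (T i)
    & T 0 *m T 1 *m T 2 *m T 3 = q^-1%:M].

Lemma mx_eigen n (A : 'M[F]_n) : (0 < n)%N ->
  exists a, ~~ row_free (A - a%:M).
Proof.
case: n A => // n A _.
have /closed_rootP[a] : size (char_poly A) != 1%N by rewrite size_char_poly.
rewrite -eigenvalue_root_char => /eigenvalueP[v va v0]; exists a.
apply: contra_neqN v0 => /row_freeP[B AB].
by rewrite -[v]mulmx1 -AB mulmxA mulmxBr va mul_mx_scalar subrr mul0mx.
Qed.

Lemma mx_irr_schur n (T : 'Z_4 -> 'M[F]_n) (B : 'M[F]_n) : mx_irr T ->
  (forall i, T i *m B = B *m T i) -> exists b, B = b%:M.
Proof.
move=> [n0 irr] TB; have [a nfree] := mx_eigen B n0; exists a.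
have [|/subr0_eq//|] := irr _ (B - a%:M); last by rewrite (negbTE nfree).
by move=> i; exists (T i); rewrite mulmxBr mulmxBl TB scalar_mxC.
Qed.

Lemma mxtrace_nondegenerate n (M : 'M[F]_n) :
  (forall A, \tr (A *m M) = 0) -> M = 0.
Proof.
move=> M0; apply/matrixP => i j; rewrite mxE -(M0 (delta_mx j i)).
rewrite /mxtrace (bigD1 j) //= big1 => [|l lj].
  rewrite mxE (bigD1 i) //= big1 => [|l li];
    rewrite !mxE ?eqxx ?mul1r ?addr0 //.
  by rewrite (negbTE li) andbF mul0r.
by rewrite mxE big1 // => m _; rewrite mxE (negbTE lj) mul0r.
Qed.

Lemma mxvec_trace n (A B : 'M[F]_n) :
  mxvec A *m (mxvec B)^T = (\tr (A *m B^T))%:M.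
Proof.
apply/matrixP => i j; rewrite !ord1 !mxE eqxx mulr1n /mxtrace.
under [RHS]eq_bigr => a _ do rewrite mxE.
rewrite pair_bigA /=.
rewrite (reindex _ (curry_mxvec_bij n n)) /=.
by apply: eq_bigr => -[a b] _; rewrite !mxE !mxvecE.
Qed.

Lemma row_sub_line m p (K : 'M[F]_(m, p)) (w : 'rV_p) :
  (forall u : 'rV_p, (u <= K)%MS -> exists b, u = b *: w) -> (\rank K <= 1)%N.
Proof.
move=> Kw; apply: leq_trans (rank_leq_row w); apply: mxrankS.
apply/row_subP => i; have [b ->] := Kw _ (row_sub i K).
exact: scalemx_sub.
Qed.

Lemma rank_line_ker m p (w : 'rV_m) (K : 'M[F]_(m, p)) :
  (forall u : 'rV_m, u *m K = 0 -> exists b, u = b *: w) ->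
  (m <= \rank K + 1)%N.
Proof.
move=> Kw; have := @row_sub_line _ _ (kermx K) w.
rewrite mxrank_ker -leq_subLR; apply => u /sub_kermxP; exact: Kw.
Qed.

Lemma Z4_ind (P : 'Z_4 -> Prop) : P 0 -> P 1 -> P 2 -> P 3 -> forall i, P i.
Proof.
move=> p0 p1 p2 p3 [[|[|[|[|//]]]] hi];
  [move: p0|move: p1|move: p2|move: p3]; congr P; exact: val_inj.
Qed.

Lemma big_Z4 (R : Type) (idx : R) (op : Monoid.law idx) (f : 'Z_4 -> R) :
  \big[op/idx]_i f i = op (op (op (f 0) (f 1)) (f 2)) (f 3).
Proof.
rewrite !big_ord_recl big_ord0 Monoid.mulm1 !Monoid.mulmA.
by congr (op (op (op _ _) _) _); congr f; exact: val_inj.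
Qed.

(** Differentiating T_0 T_1 T_2 T_3 = q^-1 along conjugation gives the identity
    sum_i T_0 .. [T_i, A] .. T_3 = 0. It is the vanishing of a composite
    M_n -> (+)_i im [T_i, -] -> M_n, so the ranks of the two maps add up to at
    most the sum of the ranks of the [T_i, -]. The kernel of the first map
    consists of the matrices that commute with all the T_i, hence of scalars,
    and the trace pairing identifies the dual of the cokernel of the second map
    with such matrices as well. Both maps thus have rank at least n^2 - 1. *)
Lemma scott_inequality q (k : 'Z_4 -> F) n (T : 'Z_4 -> 'M[F]_n) : q != 0 ->
  daha_mx q k T -> mx_irr T ->
  (n * n <= 1 + \sum_i hrank (k i) (T i) * (n - hrank (k i) (T i)))%N.
Proof.
move=> q0 [k0 kT prodT] irr.
(* P i and Q i factor [T i, -] through its image; H L R is A |-> L A R. *)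
pose P i := col_base (ad_mx (T i)); pose Q i := row_base (ad_mx (T i)).
have [H HE] : exists H : 'M[F]_n -> 'M[F]_n -> 'M[F]_(n * n),
    forall L R A, mxvec A *m H L R = mxvec (L *m A *m R).
  by exists (fun L R => lin_mulmx L *m lin_mulmxr R) => L R A;
    rewrite mulmxA !mul_vec_lin.
pose H0 := H 1%:M (T 1 *m T 2 *m T 3); pose H1 := H (T 0) (T 2 *m T 3).
pose H2 := H (T 0 *m T 1) (T 3); pose H3 := H (T 0 *m T 1 *m T 2) 1%:M.
pose Bt := row_mx (row_mx (P 0) (P 1)) (row_mx (P 2) (P 3)).
pose D := col_mx (col_mx (Q 0 *m H0) (Q 1 *m H1))
                 (col_mx (Q 2 *m H2) (Q 3 *m H3)).
have PQ i (G : 'M_(n * n)) : P i *m (Q i *m G) = ad_mx (T i) *m G.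
  by rewrite mulmxA mulmx_base.
have BD : Bt *m D = 0.
  rewrite /Bt /D !mul_row_col !PQ.
  apply/row_matrixP => i; rewrite !rowE -[delta_mx _ _]vec_mxK mulmx0.
  set A := vec_mx _; rewrite /H0 /H1 /H2 /H3 !mulmxDr !mulmxA !mul_vec_ad.
  rewrite !HE -!raddfD /=.
  rewrite mul1mx mulmx1 !(mulmxBl, mulmxBr) !mulmxA.
  have telescope (a b c d e : 'M[F]_n) :
      b - a + (c - b) + (d - c + (e - d)) = e - a.
    by apply/matrixP => i1 j1; rewrite !mxE; ring.
  rewrite telescope prodT -!mulmxA (mulmxA (T 0)) (mulmxA (_ *m _)) prodT.
  by rewrite scalar_mxC subrr linear0.
have leftK : (n * n <= \rank Bt + 1)%N.
  apply: (@rank_line_ker _ _ (mxvec 1%:M)) => u.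
  rewrite !mul_mx_row => /eqP; rewrite !row_mx_eq0.
  move=> /andP[/andP[/eqP u0 /eqP u1] /andP[/eqP u2 /eqP u3]].
  have [|b ub] := mx_irr_schur (B := vec_mx u) irr.
    have comm i : u *m P i = 0 -> T i *m vec_mx u = vec_mx u *m T i.
      move=> uP; apply/subr0_eq/(can_inj mxvecK).
      by rewrite -mul_vec_ad vec_mxK -(mulmx_base (ad_mx _)) mulmxA uP
                 mul0mx linear0.
    by apply: Z4_ind; apply: comm.
  by exists b; rewrite -linearZ /= scalemx1 -ub vec_mxK.
have rightK : (n * n <= \rank D + 1)%N.
  rewrite -mxrank_tr; apply: (@rank_line_ker _ _ (mxvec 1%:M)) => u.
  rewrite /D !tr_col_mx !mul_mx_row => /eqP; rewrite !row_mx_eq0.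
  move=> /andP[/andP[/eqP u0 /eqP u1] /andP[/eqP u2 /eqP u3]].
  have comm i L R : u *m (Q i *m H L R)^T = 0 ->
      T i *m (R *m (vec_mx u)^T *m L) = (R *m (vec_mx u)^T *m L) *m T i.
    move=> uQ; apply/subr0_eq/mxtrace_nondegenerate => A.
    set S := (vec_mx u)^T; set M := R *m S *m L.
    have E : \tr (L *m (T i *m A - A *m T i) *m R *m S) =
        - \tr (A *m (T i *m M - M *m T i)).
      rewrite -!mulmxA mxtrace_mulC -!mulmxA (mulmxA R) -/M.
      rewrite mulmxBl mulmxBr !raddfB /= opprK addrC -!mulmxA.
      by rewrite [\tr (T i *m (A *m _))]mxtrace_mulC /M -!mulmxA.
    apply/eqP; rewrite -oppr_eq0 -E; apply/eqP.
    have /matrixP/(_ 0 0) :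
        mxvec (L *m (T i *m A - A *m T i) *m R) *m u^T = 0.
      have Qu : Q i *m H L R *m u^T = 0.
        by rewrite -[LHS]trmxK trmx_mul trmxK uQ trmx0.
      rewrite -HE -mul_vec_ad -(mulmxA (mxvec A)) -PQ -(mulmxA (mxvec A)).
      by rewrite -(mulmxA (P i)) Qu !mulmx0.
    by rewrite -{1}[u]vec_mxK mxvec_trace -/S !mxE eqxx mulr1n.
  have := comm _ _ _ u0; have := comm _ _ _ u1.
  have := comm _ _ _ u2; have := comm _ _ _ u3.
  rewrite !mulmx1 !mul1mx; set S := (vec_mx u)^T => c3 c2 c1 c0.
  (* The four cyclic rotations of the word T_1 T_2 T_3 S T_0 are all equal
     to q^-1 S, which therefore commutes with every T_i. *)
  have e0 : q^-1%:M *m S = T 1 *m T 2 *m T 3 *m S *m T 0.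
    by rewrite -c0 -prodT !mulmxA.
  have e1 : q^-1%:M *m S = T 2 *m T 3 *m S *m T 0 *m T 1.
    by rewrite e0 -[RHS]c1 !mulmxA.
  have e2 : q^-1%:M *m S = T 3 *m S *m (T 0 *m T 1) *m T 2.
    by rewrite e1 -[RHS]c2 !mulmxA.
  have e3 : q^-1%:M *m S = S *m (T 0 *m T 1 *m T 2) *m T 3.
    by rewrite e2 -[RHS]c3 !mulmxA.
  have comm_mul (X Y Z : 'M[F]_n) :
      X = Y *m Z -> Z *m Y = Y *m Z -> Z *m X = X *m Z.
    by move=> -> c; rewrite mulmxA c.
  have [|b] := mx_irr_schur (B := q^-1%:M *m S) irr.
    by apply: Z4_ind;
      [exact: comm_mul _ _ _ e0 c0|exact: comm_mul _ _ _ e1 c1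
      |exact: comm_mul _ _ _ e2 c2|exact: comm_mul _ _ _ e3 c3].
  rewrite mul_scalar_mx => Sb; exists (q * b).
  have SE : S = (q * b)%:M.
    by rewrite scalar_mxM -Sb mul_scalar_mx scalerA mulfV // scale1r.
  by rewrite -linearZ /= scalemx1 -tr_scalar_mx -SE trmxK vec_mxK.
have := mulmx0_rank_max BD.
have := hecke_commutator_rank (k0 0) (kT 0).
have := hecke_commutator_rank (k0 1) (kT 1).
have := hecke_commutator_rank (k0 2) (kT 2).
have := hecke_commutator_rank (k0 3) (kT 3).
by rewrite big_Z4 /=; lia.
Qed.

Definition flip_sign (s : 'Z_4 -> bool) (k : 'Z_4 -> F) : 'Z_4 -> F :=
  fun i => if s i then (k i)^-1 else k i.

Lemma daha_mx_flip q k n (T : 'Z_4 -> 'M[F]_n) s :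
  daha_mx q k T -> daha_mx q (flip_sign s k) T.
Proof.
case=> k0 kT prodT; split=> // i; rewrite /flip_sign; case: (s i) => //.
  by rewrite invr_eq0.
exact: heckeV.
Qed.

Definition low_rank n (T : 'Z_4 -> 'M[F]_n) (k : 'Z_4 -> F) : Prop :=
  forall i, (2 * hrank (k i) (T i) <= n)%N.

Definition low_sign n (T : 'Z_4 -> 'M[F]_n) (k : 'Z_4 -> F) (i : 'Z_4) : bool :=
  (n < 2 * hrank (k i) (T i))%N.

(** The ranks of T - k and T - k^-1 add up to at most n, so one of them is at
    most n / 2. *)
Lemma low_signP q k n (T : 'Z_4 -> 'M[F]_n) :
  daha_mx q k T -> low_rank T (flip_sign (low_sign T k) k).
Proof.
case=> k0 kT _ i; rewrite /flip_sign /low_sign.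
by case: ltnP => //= lt; exact: hecke_rank_flip (kT i) lt.
Qed.

(** Scott's inequality, rewritten with 4 r (n - r) = n^2 - (n - 2 r)^2. *)
Lemma defect_bound q k n (T : 'Z_4 -> 'M[F]_n) : q != 0 ->
  daha_mx q k T -> mx_irr T -> low_rank T k ->
  (\sum_i (n - 2 * hrank (k i) (T i)) ^ 2 <= 4)%N.
Proof.
move=> q0 qkT irr low; have := scott_inequality q0 qkT irr.
have sq r : (2 * r <= n)%N -> (4 * (r * (n - r)) + (n - 2 * r) ^ 2 = n * n)%N.
  move=> rn; have {rn} -> : n = (2 * r + (n - 2 * r))%N by rewrite subnKC.
  by move: (n - 2 * r)%N => e; nia.
move: (sq _ (low 0)) (sq _ (low 1)) (sq _ (low 2)) (sq _ (low 3)).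
rewrite !big_Z4 /=; move: (_ * (n - _))%N (_ ^ 2)%N => a0 b0.
move: (_ * (n - _))%N (_ ^ 2)%N => a1 b1.
move: (_ * (n - _))%N (_ ^ 2)%N => a2 b2.
move: (_ * (n - _))%N (_ ^ 2)%N => a3 b3.
by move: (n * n)%N => nn; lia.
Qed.

Lemma daha_mx_det q k n (T : 'Z_4 -> 'M[F]_n) :
  daha_mx q k T -> low_rank T k ->
  \prod_i k i ^+ (n - 2 * hrank (k i) (T i)) = q ^- n.
Proof.
case=> k0 kT prodT low.
have detT i : k i ^+ (n - 2 * hrank (k i) (T i)) = \det (T i).
  apply: (mulIf (expf_neq0 (2 * hrank (k i) (T i)) (k0 i))).
  by rewrite -exprD subnK // hecke_det.
rewrite (eq_bigr _ (fun i _ => detT i)) big_Z4 /=.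
by rewrite -!det_mulmx prodT det_scalar exprVn.
Qed.

Section NotRoot.
Variables (q : F) (q0 : q != 0).
Hypothesis q_nroot : forall n : nat, (0 < n)%N -> ~~ n.-unity_root q.

Lemma q_expn_inj : injective (fun n => q ^- n).
Proof.
have lt m n : (m < n)%N -> q ^- m != q ^- n.
  move=> mn; apply: contra (q_nroot (n := n - m) _); last by rewrite subn_gt0.
  move=> /eqP /invr_inj E; apply/unity_rootP.
  apply: (mulfI (expf_neq0 m q0)); rewrite -exprD subnKC 1?ltnW //.
  by rewrite mulr1.
move=> m n /= /eqP E; case: (ltngtP m n) => // h; move: (lt _ _ h).
  by rewrite E.
by rewrite eq_sym E.
Qed.

(** The n - 2 r_i are even with squares summing to at most 4, so at most one of
    them is nonzero; they cannot all vanish, because q^n <> 1. *)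
Lemma irr_even k n (T : 'Z_4 -> 'M[F]_n) :
  daha_mx q k T -> mx_irr T -> low_rank T k -> ~~ odd n ->
  exists j, [/\ n = (2 * hrank (k j) (T j)).+2, k j ^+ 2 = q ^- n
    & forall i, i != j -> n = (2 * hrank (k i) (T i))%N].
Proof.
move=> qkT irr low n_even; have := defect_bound q0 qkT irr low.
have := daha_mx_det qkT low.
set e := fun i => (n - 2 * hrank (k i) (T i))%N => det bound.
have [j ej] : exists j, e j != 0.
  apply/existsP; apply: contraT; rewrite negb_exists => /forallP e0.
  have: q ^- n = q ^- 0.
    rewrite -det expr0 invr1 big1 // => i _.
    by move: (e0 i); rewrite negbK => /eqP; rewrite /e => ->.
  by move/q_expn_inj; case: irr => n0 _ n00; move: n0; rewrite n00.
have even i : ~~ odd (e i).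
  by rewrite /e oddB ?low // mul2n odd_double addbF.
have split_sq x r : (x ^ 2 + r <= 4)%N -> ~~ odd x -> x != 0%N ->
    x = 2 /\ r = 0%N.
  case: x => [|[|[|x]]] //; first by rewrite !expnS expn0; lia.
  have : (3 ^ 2 <= x.+3 ^ 2)%N by rewrite leq_exp2r.
  by rewrite !expnS !expn0; lia.
move: bound; rewrite (bigD1 j) //= => /split_sq.
move=> /(_ (even j) ej)[ej2 /eqP]; rewrite sum_nat_eq0 => /forallP ei0.
have {}ei0 i : i != j -> e i = 0%N.
  by move=> ij; move: (ei0 i); rewrite ij /= expn_eq0 andbT => /eqP.
exists j; split.
- by move: (low j) ej2; rewrite /e; lia.
- rewrite -det (bigD1 j) //= ej2 big1 ?mulr1 // => i ij.
  by rewrite -[(n - _)%N]/(e i) ei0.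
- by move=> i /ei0; move: (low i); rewrite /e; lia.
Qed.

(** The n - 2 r_i are odd with squares summing to at most 4, so all are 1. *)
Lemma irr_odd k n (T : 'Z_4 -> 'M[F]_n) :
  daha_mx q k T -> mx_irr T -> low_rank T k -> odd n ->
  \prod_i k i = q ^- n.
Proof.
move=> qkT irr low n_odd; have := defect_bound q0 qkT irr low.
rewrite -(daha_mx_det qkT low) => bound; apply: eq_bigr => i _.
suff -> : (n - 2 * hrank (k i) (T i) = 1)%N by rewrite expr1.
have pos j : (0 < n - 2 * hrank (k j) (T j))%N.
  rewrite subn_gt0 ltn_neqAle low andbT; apply: contraTneq n_odd => <-.
  by rewrite mul2n odd_double.
(* The tangent to the parabola at 1 makes the bound on the squares linear. *)
have tangent a : (0 < a -> 3 * a <= a ^ 2 + 2)%N.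
  by case: a => [|[|a]] // _; rewrite !expnS expn0 muln1 mulnS; lia.
move: bound; rewrite !big_Z4 /=.
move: (tangent _ (pos 0)) (tangent _ (pos 1)) (tangent _ (pos 2)).
move: (tangent _ (pos 3)) (pos 0) (pos 1) (pos 2) (pos 3).
by move=> *; move: i; apply: Z4_ind; lia.
Qed.

End NotRoot.
End Irreducible.

(** * Composition factors *)

Section Subquotient.
Variable F : closedFieldType.
Implicit Types (q : F) (k : 'Z_4 -> F).

Lemma daha_mx_sub q k n r (T : 'Z_4 -> 'M[F]_n) (S : 'Z_4 -> 'M[F]_r)
    (B : 'M[F]_(n, r)) (B' : 'M[F]_(r, n)) :
  B' *m B = 1%:M -> (forall i, T i *m B = B *m S i) ->
  daha_mx q k T -> daha_mx q k S.
Proof.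
move=> B'B TB [k0 kT prodT].
have inj X Y : B *m X = B *m Y -> X = Y :> 'M_r.
  by move=> /(congr1 (mulmx B')); rewrite !mulmxA B'B !mul1mx.
split=> // [i|]; apply: inj.
- rewrite mulmxA -TB -mulmxA -TB mulmxA kT mulmxBl mulmxBr -scalemxAl TB.
  by rewrite scalemxAr mul1mx mulmx1.
- by rewrite !mulmxA -TB -!mulmxA (mulmxA B) -TB -!mulmxA (mulmxA B) -TB
    -!mulmxA -TB !mulmxA prodT scalar_mxC.
Qed.

Lemma daha_mx_quo q k n r (T : 'Z_4 -> 'M[F]_n) (S : 'Z_4 -> 'M[F]_r)
    (B : 'M[F]_(r, n)) (B' : 'M[F]_(n, r)) :
  B *m B' = 1%:M -> (forall i, B *m T i = S i *m B) ->
  daha_mx q k T -> daha_mx q k S.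
Proof.
move=> BB' BT [k0 kT prodT].
have inj X Y : X *m B = Y *m B -> X = Y :> 'M_r.
  by move=> /(congr1 (mulmx^~ B')); rewrite -!mulmxA BB' !mulmx1.
split=> // [i|]; apply: inj.
- rewrite -mulmxA -BT mulmxA -BT -mulmxA kT mulmxBl mulmxBr -scalemxAr BT.
  by rewrite scalemxAl mul1mx mulmx1.
- by rewrite -!mulmxA -BT (mulmxA (S 2)) -BT !mulmxA -(mulmxA _ (S 1)) -BT
    !mulmxA -BT -!mulmxA (mulmxA (T 0)) (mulmxA _ _ (T 3)) prodT scalar_mxC.
Qed.

(** Frobenius' rank inequality for the product L (T - k) B, which is 0. *)
Lemma hrank_subquotient (k : F) n r s (T : 'M[F]_n) (T1 : 'M[F]_r)
    (T2 : 'M[F]_s) (B : 'M[F]_(n, r)) (L : 'M[F]_(s, n)) :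
  row_free L -> row_full B -> L *m B = 0 -> T *m B = B *m T1 ->
  L *m T = T2 *m L -> (hrank k T1 + hrank k T2 <= hrank k T)%N.
Proof.
move=> Lf Bf LB TB LT.
have NB : (T - k%:M) *m B = B *m (T1 - k%:M).
  by rewrite mulmxBl mulmxBr TB scalar_mxC.
have LN : L *m (T - k%:M) = (T2 - k%:M) *m L.
  by rewrite mulmxBl mulmxBr LT scalar_mxC.
have := mxrank_Frobenius L (T - k%:M) B.
rewrite -mulmxA NB mulmxA LB mul0mx mxrank0 addn0 LN mxrankMfree //.
by rewrite -[\rank (B *m _)]mxrank_tr trmx_mul mxrankMfree ?mxrank_tr 1?addnC //
   /row_free mxrank_tr.
Qed.

(** The ranks of T_0 - k_0 on a submodule and on its quotient add up to at most
    the rank on the whole, so a reducible T has a proper submodule or quotient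
    on which this rank is still less than half the dimension. *)
Lemma exists_irr_factor q k n (T : 'Z_4 -> 'M[F]_n) :
  daha_mx q k T -> (2 * hrank (k 0%R) (T 0%R) < n)%N ->
  mx_irr T \/ exists m (T' : 'Z_4 -> 'M[F]_m),
    [/\ (m < n)%N, daha_mx q k T', mx_irr T'
      & (2 * hrank (k 0%R) (T' 0%R) < m)%N].
Proof.
elim/ltn_ind: n T => n IH T qkT lowT.
have [|Tred] := EM (mx_irr T); first by left.
have n0 : (0 < n)%N by apply: leq_ltn_trans lowT.
right; have [m [K [TK K0 Kf]]] : exists m (K : 'M[F]_(n, m)),
    [/\ forall i, exists S, T i *m K = K *m S, K != 0 & ~~ row_free K].
  apply: contrapT => noK; apply: Tred; split=> // m K TK.
  have [->|K0] := eqVneq K 0; first by left.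
  have [|Kf] := boolP (row_free K); first by right.
  by case: noK; exists m, K.
have r0 : (0 < \rank K)%N by rewrite lt0n mxrank_eq0.
have rn : (\rank K < n)%N by rewrite ltn_neqAle Kf rank_leq_row.
have [B' B'B] : exists B', B' *m col_base K = 1%:M.
  by apply/row_fullP/col_base_full.
have [R RR] : exists R, row_base K *m R = 1%:M.
  by apply/row_freeP/row_base_free.
have : forall i, exists S, T i *m col_base K = col_base K *m S.
  move=> i; have [S TS] := TK i.
  have : T i *m (col_base K *m row_base K) = col_base K *m row_base K *m S.
    by rewrite mulmx_base.
  move: (col_base K) (row_base K) R RR => B Rb R RR {}TS.
  exists (Rb *m S *m R).
  have -> : T i *m B = T i *m (B *m Rb) *m R by rewrite -!mulmxA RR mulmx1.
  by rewrite TS !mulmxA.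
have Bfull := col_base_full K; clear R RR TK Kf.
move: {K K0} (\rank K) r0 rn (col_base K) B' B'B Bfull.
move=> r r0 rn B B' B'B Bfull.
move=> /choice[S TB].
have LB : row_base (kermx B) *m B = 0 by apply/sub_kermxP; rewrite eq_row_base.
(* The rows of the left kernel of B are coordinates on the quotient. *)
have : forall i, exists S2,
    row_base (kermx B) *m T i = S2 *m row_base (kermx B).
  move=> i; apply/submxP; rewrite eq_row_base; apply/sub_kermxP.
  by rewrite -mulmxA TB mulmxA LB mul0mx.
move=> /choice[S2 LT].
have [L' LL'] : exists L', row_base (kermx B) *m L' = 1%:M.
  by apply/row_freeP/row_base_free.
have qkS := daha_mx_sub B'B TB qkT; have qkS2 := daha_mx_quo LL' LT qkT.
have := hrank_subquotient (k 0) (row_base_free _) Bfull LB (TB 0) (LT 0).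
have sE : \rank (kermx B) = (n - r)%N.
  by rewrite mxrank_ker (eqP Bfull).
clear m; have sub m (S' : 'Z_4 -> 'M[F]_m) : (m < n)%N -> daha_mx q k S' ->
    (2 * hrank (k 0%R) (S' 0%R) < m)%N -> exists m' (T' : 'Z_4 -> 'M[F]_m'),
    [/\ (m' < n)%N, daha_mx q k T', mx_irr T'
      & (2 * hrank (k 0%R) (T' 0%R) < m')%N].
  move=> mn qkS' lowS'.
  have [irr|[m' [T' [? ? ? ?]]]] := IH _ mn _ qkS' lowS'.
    by exists m, S'.
  by exists m', T'; split=> //; apply: ltn_trans mn.
move=> le; have [lowS|lowS] := ltnP (2 * hrank (k 0%R) (S 0%R))%N r.
  exact: sub qkS lowS.
apply: (sub _ _ _ qkS2); first by rewrite sE; lia.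
move: lowT lowS le sE r0 rn.
move: (hrank _ (T 0)) (hrank _ (S 0)) (hrank _ (S2 0)) => a b c.
by move: (\rank (kermx B)) => m; lia.
Qed.

(** A proper irreducible factor of dimension m with 2 r_0 < m would give
    k_0^2 = q^-m <> q^-n if m is even, and one of the excluded products if m is
    odd. *)
Lemma daha_mx_irr q k n (T : 'Z_4 -> 'M[F]_n) : q != 0 ->
  (forall n : nat, (0 < n)%N -> ~~ n.-unity_root q) ->
  ~~ odd n -> k 0 ^+ 2 = q ^- n ->
  (forall s i, s 0 = false -> odd i -> (i < n)%N ->
     \prod_j flip_sign s k j != q ^- i) ->
  daha_mx q k T -> (2 * hrank (k 0%R) (T 0%R) < n)%N -> mx_irr T.
Proof.
move=> q0 q_nroot n_even k0n kprod qkT /(exists_irr_factor qkT)[//|].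
move=> [m [T' [mn qkT' irr lowT']]]; exfalso.
have qk'T' := daha_mx_flip (low_sign T' k) qkT'.
have low := low_signP qkT'.
have s0 : low_sign T' k 0 = false by rewrite /low_sign ltnNge ltnW.
have [m_odd|m_even] := boolP (odd m).
  have := irr_odd q0 qk'T' irr low m_odd.
  by apply/eqP/kprod.
have [j [_ kj kother]] := irr_even q0 q_nroot qk'T' irr low m_even.
have j0 : j = 0.
  apply/eqP; apply: contraT; rewrite eq_sym => /kother.
  by rewrite /flip_sign s0 => mE; move: lowT'; rewrite -mE ltnn.
move: kj; rewrite j0 /flip_sign s0 k0n => /(q_expn_inj q0 q_nroot) nm.
by move: mn; rewrite nm ltnn.
Qed.

End Subquotient.

(** * Chains generated by a common eigenvector of t_0 and t_3 *)

Section Chain.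
Variables (F : fieldType) (q k0 k1 k2 k3 : F) (n : nat).
Variables T0 T1 T2 T3 : 'M[F]_n.
Hypotheses (qn : q != 0) (k0n : k0 != 0) (k1n : k1 != 0) (k2n : k2 != 0)
  (k3n : k3 != 0).
Hypotheses (h0 : hecke k0 T0) (h1 : hecke k1 T1) (h2 : hecke k2 T2)
  (h3 : hecke k3 T3).
Hypothesis prodT : T0 *m T1 *m T2 *m T3 = q^-1%:M.

Lemma hecke_vec k (T : 'M[F]_n) (w : 'cV_n) : hecke k T ->
  T *m (T *m w) = (k + k^-1) *: (T *m w) - w.
Proof. by move=> h; rewrite mulmxA h mulmxBl mul1mx scalemxAl. Qed.

Lemma hecke_inj k (T : 'M[F]_n) (w w' : 'cV_n) : hecke k T ->
  T *m w = T *m w' -> w = w'.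
Proof.
move=> h E; have := hecke_vec w h; rewrite E (hecke_vec w' h).
by move/addrI/oppr_inj.
Qed.

(** Solves a vector equation for one of its terms: the side condition is an
    identity of rational functions in each coordinate. *)
Lemma eq_of_comb (c : F) (L R X Y : 'cV[F]_n) :
  L = R -> X - Y = c *: (L - R) -> X = Y.
Proof. by move=> ->; rewrite subrr scaler0 => /subr0_eq. Qed.

Definition chain_f (x : F) := (1 - x) * (1 - k0 ^+ 2 * x).
Definition chain_g (x : F) :=
  (k0 * k1 * k3 * x - k2) * (k0 * k1 * k3 * x - k2^-1).

(** The formulas defining E, for an infinite sequence of vectors: the relations
    by which v_0 generates the universal module with a given common eigenvector
    of t_0 and t_3. At i = 0 the coefficient of w i.-1 vanishes. *)
Record chain_rel (w : nat -> 'cV[F]_n) : Prop := ChainRel {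
  chain_t0_even i : ~~ odd i -> T0 *m w i =
    (k0^-1 * q ^- i * chain_f (q ^+ i)) *: w i.-1
    + (k0 + k0^-1 - k0^-1 * q ^- i) *: w i;
  chain_t0_odd i : ~~ odd i -> T0 *m w i.+1 =
    (k0^-1 * q ^- i.+2) *: (w i.+1 - w i.+2);
  chain_t1_even i : ~~ odd i -> T1 *m w i =
    - (k1 * chain_f (q ^+ i)) *: w i.-1 + k1 *: w i + k1^-1 *: w i.+1;
  chain_t1_odd i : ~~ odd i -> T1 *m w i.+1 = k1^-1 *: w i.+1;
  chain_t2_even i : ~~ odd i -> T2 *m w i =
    (k0^-1 * k1^-1 * k3^-1 * q ^- i.+1) *: (w i - w i.+1);
  chain_t2_odd i : ~~ odd i -> T2 *m w i.+1 =
    (chain_g (q ^+ i.+1) / (k0 * k1 * k3 * q ^+ i.+1)) *: w i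
    + (k2 + k2^-1 - k0^-1 * k1^-1 * k3^-1 * q ^- i.+1) *: w i.+1;
  chain_t3_even i : ~~ odd i -> T3 *m w i = k3 *: w i;
  chain_t3_odd i : ~~ odd i -> T3 *m w i.+1 =
    - (k3^-1 * chain_g (q ^+ i.+1)) *: w i
    + k3^-1 *: w i.+1 + k3 *: w i.+2 }.

Local Ltac lin :=
  rewrite ?(mulmxDr, mulmxBr, mulmxN, mulmx0, =^~ scalemxAr).
Local Ltac ent := apply/colP => ?; rewrite !mxE /=.

(** Two steps of the chain, from v_i = e with i even to o = v_(i+1) and
    e' = v_(i+2), where x = q^i. The vector a is chain_f x *: v_(i-1): scaling
    v_(i-1) by this factor lets the step start at i = 0, where a = 0. The last
    two hypotheses define o and e'; the conclusions follow from the quadratic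
    relations, applied to e and o, and from the product relation. *)
Lemma chain_step (x : F) (a e o e' : 'cV[F]_n) : x != 0 ->
  T1 *m a = k1^-1 *: a ->
  T0 *m a = (k0^-1 * x^-1) *: (a - chain_f x *: e) ->
  T0 *m e = (k0^-1 * x^-1) *: a + (k0 + k0^-1 - k0^-1 * x^-1) *: e ->
  T3 *m e = k3 *: e ->
  T1 *m e = - k1 *: a + k1 *: e + k1^-1 *: o ->
  T0 *m o = (k0^-1 * (q * (q * x))^-1) *: (o - e') ->
  [/\ T1 *m o = k1^-1 *: o,
      T2 *m e = (k0^-1 * k1^-1 * k3^-1 * (q * x)^-1) *: (e - o),
      T2 *m o = (chain_g (q * x) / (k0 * k1 * k3 * (q * x))) *: e
        + (k2 + k2^-1 - k0^-1 * k1^-1 * k3^-1 * (q * x)^-1) *: o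
    & [/\ T3 *m o = - (k3^-1 * chain_g (q * x)) *: e + k3^-1 *: o + k3 *: e',
      T3 *m e' = k3 *: e'
    & T0 *m e' = (k0^-1 * (q * (q * x))^-1 * chain_f (q * (q * x))) *: o
        + (k0 + k0^-1 - k0^-1 * (q * (q * x))^-1) *: e']].
Proof.
move=> xn T1a T0a T0e T3e T1e T0o.
have T1o : T1 *m o = k1^-1 *: o.
  have := hecke_vec e h1; rewrite {1}T1e; lin; rewrite T1a T1e => E.
  by move: (T1 *m o) E => y E; apply: (eq_of_comb (c := k1) E); ent; field.
have T2e : T2 *m e = (k0^-1 * k1^-1 * k3^-1 * (q * x)^-1) *: (e - o).
  apply: (hecke_inj h1); apply: (hecke_inj h0).
  have -> : T0 *m (T1 *m (T2 *m e)) = (k3^-1 * q^-1) *: e.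
    have := congr1 (mulmx^~ e) prodT; rewrite -!mulmxA T3e mul_scalar_mx; lin.
    by move=> E; apply: (eq_of_comb (c := k3^-1) E); ent; field; rewrite k3n qn.
  lin; rewrite T1e T1o; lin; rewrite T0e T0a; ent; rewrite /chain_f; field.
  by rewrite k0n k1n k3n qn xn.
have T2o : T2 *m o = (chain_g (q * x) / (k0 * k1 * k3 * (q * x))) *: e
        + (k2 + k2^-1 - k0^-1 * k1^-1 * k3^-1 * (q * x)^-1) *: o.
  have := hecke_vec e h2; rewrite {1}T2e; lin; rewrite T2e => E.
  move: (T2 *m o) E => y E.
  apply: (eq_of_comb (c := - (k0 * k1 * k3 * (q * x))) E).
  by ent; rewrite /chain_g; field; rewrite k0n k1n k2n k3n qn xn.
have T3o : T3 *m o =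
    - (k3^-1 * chain_g (q * x)) *: e + k3^-1 *: o + k3 *: e'.
  have := congr1 (mulmx^~ ((k3 + k3^-1) *: o - T3 *m o)) prodT.
  rewrite -!mulmxA mul_scalar_mx mulmxBr -scalemxAr (hecke_vec o h3) subKr.
  rewrite T2o; lin; rewrite T1e T1o; lin; rewrite T0a T0e T0o => E.
  move: (T3 *m o) E => y E; apply: (eq_of_comb (c := q) E).
  by ent; rewrite /chain_g /chain_f; field; rewrite k0n k1n k2n k3n qn xn.
split=> //; split=> //.
- have := hecke_vec o h3; rewrite {1}T3o; lin; rewrite T3e T3o => E.
  move: (T3 *m e') E => y E; apply: (eq_of_comb (c := k3^-1) E).
  by ent; field; rewrite k3n.
- have := hecke_vec o h0; rewrite {1}T0o; lin; rewrite T0o => E.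
  move: (T0 *m e') E => y E.
  apply: (eq_of_comb (c := - (k0 * (q * (q * x)))) E).
  by ent; rewrite /chain_f; field; rewrite k0n qn xn.
Qed.

(** The formulas for t_1 v_i with i even and for t_0 v_i with i odd, solved for
    v_(i+1). As v_(-1) has coefficient 0, the recursion may start at (0, v_0). *)
Definition chain_next (i : nat) (p : 'cV[F]_n * 'cV[F]_n) :=
  (p.2, if odd i then p.2 - (k0 * q ^+ i.+1) *: (T0 *m p.2)
        else k1 *: (T1 *m p.2 + (k1 * chain_f (q ^+ i)) *: p.1 - k1 *: p.2)).

Fixpoint chain_pair (v : 'cV[F]_n) (i : nat) : 'cV[F]_n * 'cV[F]_n :=
  if i is j.+1 then chain_next j (chain_pair v j) else (0, v).

Definition chain v i := (chain_pair v i).2.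

Lemma chain_pairE v i : (chain_pair v i.+1).1 = chain v i.
Proof. by []. Qed.

Lemma chainS v i : chain v i.+1 =
  if odd i then chain v i - (k0 * q ^+ i.+1) *: (T0 *m chain v i)
  else k1 *: (T1 *m chain v i + (k1 * chain_f (q ^+ i)) *: chain v i.-1
     - k1 *: chain v i).
Proof.
case: i => [|i].
  by rewrite /chain /= /chain_f expr0 subrr mul0r mulr0 !scale0r.
have E : chain_pair v i.+1 = (chain v i, chain v i.+1).
  by rewrite -chain_pairE -surjective_pairing.
by rewrite -[LHS]/((chain_next i.+1 (chain_pair v i.+1)).2) E.
Qed.

Section FromEigenvector.
Variable v : 'cV[F]_n.
Hypotheses (T0v : T0 *m v = k0 *: v) (T3v : T3 *m v = k3 *: v).
Local Notation w := (chain v).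

Lemma chain_T0_odd i : odd i ->
  T0 *m w i = (k0^-1 * q ^- i.+1) *: (w i - w i.+1).
Proof.
move=> oi; rewrite chainS oi opprB addrCA subrr addr0 scalerA.
by rewrite mulrACA mulVf // mul1r mulVf ?expf_neq0 // scale1r.
Qed.

Lemma chain_T1_even i : ~~ odd i ->
  T1 *m w i = - (k1 * chain_f (q ^+ i)) *: w i.-1 + k1 *: w i + k1^-1 *: w i.+1.
Proof.
move=> oi; rewrite chainS (negbTE oi) scalerA mulVf // scale1r scaleNr.
move: (T1 *m w i) (_ *: w i.-1) (_ *: w i) => x y z.
by apply/colP => j; rewrite !mxE; ring.
Qed.

Lemma chain_even_step i : ~~ odd i ->
  let a := chain_f (q ^+ i) *: w i.-1 in
  T1 *m a = k1^-1 *: a ->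
  T0 *m a = (k0^-1 * q ^- i) *: (a - chain_f (q ^+ i) *: w i) ->
  T0 *m w i = (k0^-1 * q ^- i) *: a + (k0 + k0^-1 - k0^-1 * q ^- i) *: w i ->
  T3 *m w i = k3 *: w i ->
  [/\ T1 *m w i.+1 = k1^-1 *: w i.+1,
      T2 *m w i = (k0^-1 * k1^-1 * k3^-1 * q ^- i.+1) *: (w i - w i.+1),
      T2 *m w i.+1 = (chain_g (q ^+ i.+1) / (k0 * k1 * k3 * q ^+ i.+1)) *: w i
        + (k2 + k2^-1 - k0^-1 * k1^-1 * k3^-1 * q ^- i.+1) *: w i.+1
    & [/\ T3 *m w i.+1 = - (k3^-1 * chain_g (q ^+ i.+1)) *: w i
         + k3^-1 *: w i.+1 + k3 *: w i.+2,
      T3 *m w i.+2 = k3 *: w i.+2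
    & T0 *m w i.+2 = (k0^-1 * q ^- i.+2 * chain_f (q ^+ i.+2)) *: w i.+1
        + (k0 + k0^-1 - k0^-1 * q ^- i.+2) *: w i.+2]].
Proof.
move=> oi a T1a T0a T0e T3e; rewrite !(exprS q i.+1) !(exprS q i).
apply: chain_step T1a T0a T0e T3e _ _; first by rewrite expf_neq0.
  by rewrite chain_T1_even // scalerA mulNr.
by rewrite chain_T0_odd //= !exprS.
Qed.

(** The hypotheses of the step propagate along the chain; at i = 0 they are the
    eigenvector equations of v. *)
Lemma chain_start i : ~~ odd i ->
  let a := chain_f (q ^+ i) *: w i.-1 in
  [/\ T1 *m a = k1^-1 *: a,
    T0 *m a = (k0^-1 * q ^- i) *: (a - chain_f (q ^+ i) *: w i),
    T0 *m w i = (k0^-1 * q ^- i) *: a + (k0 + k0^-1 - k0^-1 * q ^- i) *: w i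
  & T3 *m w i = k3 *: w i].
Proof.
elim/ltn_ind: i => -[|[//|i]] IH oi /=.
  rewrite /chain_f expr0 subrr mul0r !scale0r !mulmx0 subr0 !scaler0 add0r.
  by rewrite invr1 mulr1 addrK.
have oi' : ~~ odd i by rewrite /= negbK in oi.
have [T1a T0a T0e T3e] := IH i (ltnW (ltnSn _)) oi'.
have [T1o T2e T2o [T3o T3e' T0e']] := chain_even_step oi' T1a T0a T0e T3e.
split=> //.
- by rewrite -!scalemxAr T1o !scalerA mulrC.
- by rewrite -scalemxAr chain_T0_odd //= -scalerBr !scalerA mulrC.
- by rewrite scalerA.
Qed.

Lemma chain_satisfies : chain_rel w.
Proof.
split=> i oi; have [T1a T0a T0e T3e] := chain_start oi;
  have [T1o T2e T2o [T3o _ _]] := chain_even_step oi T1a T0a T0e T3e => //.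
- by rewrite T0e scalerA.
- exact: chain_T0_odd.
- exact: chain_T1_even.
Qed.

End FromEigenvector.
End Chain.

(** * Bases formed by chains *)

Local Notation chain_relZ q k0 k1 k2 k3 T w :=
  (chain_rel q k0 k1 k2 k3 (T 0%R) (T 1%R) (T 2%R) (T 3%R) w).

Section ChainRel.
Variable F : fieldType.

Definition quad_fun (k0 k1 k2 k3 : F) (j : 'Z_4) : F :=
  match val j with 0 => k0 | 1 => k1 | 2 => k2 | _ => k3 end.

Lemma chain_exists (q k0 k1 k2 k3 : F) n (T : 'Z_4 -> 'M[F]_n) :
  [/\ forall i, quad_fun k0 k1 k2 k3 i != 0,
    forall i, hecke (quad_fun k0 k1 k2 k3 i) (T i)
    & T 0 *m T 1 *m T 2 *m T 3 = q^-1%:M] ->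
  q != 0 -> forall v, T 0 *m v = k0 *: v -> T 3 *m v = k3 *: v ->
  exists w, w 0%N = v /\ chain_relZ q k0 k1 k2 k3 T w.
Proof.
case=> kn hT prodT qn v T0v T3v.
exists (chain q k0 k1 (T 0) (T 1) v); split=> //.
exact: (chain_satisfies qn (kn 0) (kn 1) (kn 2) (kn 3)
  (hT 0) (hT 1) (hT 2) (hT 3) prodT T0v T3v).
Qed.

Definition span_mx n (w : nat -> 'cV[F]_n) m : 'M[F]_(m, n) :=
  \matrix_(i < m) (w i)^T.

Lemma span_mxP n (w : nat -> 'cV[F]_n) m i :
  (i < m)%N -> ((w i)^T <= span_mx w m)%MS.
Proof.
move=> im; rewrite -(rowK (fun i : 'I_m => (w i)^T) (Ordinal im)).
exact: row_sub.
Qed.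

Lemma span_mx_sub n (w : nat -> 'cV[F]_n) m p (K : 'M[F]_(p, n)) :
  (forall i, (i < m)%N -> ((w i)^T <= K)%MS) -> (span_mx w m <= K)%MS.
Proof. by move=> wK; apply/row_subP => i; rewrite rowK wK. Qed.

(** The tridiagonal shape is what makes the span of an initial segment invariant
    as soon as it contains the next vector. *)
Lemma chain_hess (q k0 k1 k2 k3 : F) n (T : 'Z_4 -> 'M[F]_n) w :
  chain_relZ q k0 k1 k2 k3 T w -> forall j i, exists a b c,
  T j *m w i = a *: w i.-1 + b *: w i + c *: w i.+1.
Proof.
move=> R j i; have [oi|/negbNE oi] := boolP (~~ odd i).
  move: j; apply: Z4_ind.
  - rewrite (chain_t0_even R oi); do 2 eexists; exists 0.
    by rewrite scale0r addr0.
  - by rewrite (chain_t1_even R oi); do 3 eexists.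
  - rewrite (chain_t2_even R oi); exists 0; do 2 eexists.
    by rewrite scale0r add0r scalerBr -scaleNr.
  - rewrite (chain_t3_even R oi); exists 0; eexists; exists 0.
    by rewrite !scale0r add0r addr0.
case: i oi => // i oi; move: j; apply: Z4_ind.
- rewrite (chain_t0_odd R oi); exists 0; do 2 eexists.
  by rewrite scale0r add0r scalerBr -scaleNr.
- rewrite (chain_t1_odd R oi); exists 0; eexists; exists 0.
  by rewrite !scale0r add0r addr0.
- rewrite (chain_t2_odd R oi); do 2 eexists; exists 0.
  by rewrite scale0r addr0.
- by rewrite (chain_t3_odd R oi); do 3 eexists.
Qed.

End ChainRel.

Section ChainBasis.
Variable F : closedFieldType.

(** If w m depends on w 0, ..., w (m - 1) then these span an invariant subspace,
    hence everything; so w m is independent of them as long as m < n. *)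
Lemma chain_span_rank n (T : 'Z_4 -> 'M[F]_n) (w : nat -> 'cV[F]_n) :
  mx_irr T -> w 0%N != 0 ->
  (forall j i, exists a b c,
     T j *m w i = a *: w i.-1 + b *: w i + c *: w i.+1) ->
  forall m, (m <= n)%N -> (m <= \rank (span_mx w m))%N.
Proof.
move=> [n0 irr] w0 hess; elim=> // m IH mn; have {}IH := IH (ltnW mn).
have [dep|indep] := boolP ((w m)^T <= span_mx w m)%MS; last first.
  apply: leq_ltn_trans IH _; apply: rank_ltmx; rewrite ltmxE; apply/andP; split.
    by apply: span_mx_sub => i im; apply/span_mxP/ltnW.
  by apply: contra indep; apply: submx_trans; apply: span_mxP.
have wS i : (i <= m)%N -> ((w i)^T <= span_mx w m)%MS.
  by rewrite leq_eqVlt => /orP[/eqP->//|]; apply: span_mxP.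
have [|/eqP K0|Kf] := irr _ (span_mx w m)^T.
- move=> j; have : (span_mx w m *m (T j)^T <= span_mx w m)%MS.
    apply/row_subP => i; rewrite row_mul rowK -trmx_mul.
    have [a [b [c ->]]] := hess j i; rewrite !linearD !linearZ /=.
    have im := ltn_ord i.
    rewrite !addmx_sub ?scalemx_sub ?wS // ?(ltnW im) //.
    by rewrite (leq_trans (leq_pred _)) // ltnW.
  case/submxP => D E; exists D^T.
  by rewrite -[LHS]trmxK trmx_mul trmxK E trmx_mul.
- have S0 : span_mx w m = 0 by rewrite -[LHS]trmxK (eqP K0) trmx0.
  case/submxP: (wS 0%N (leq0n _)) => D; rewrite S0 mulmx0 => /(congr1 trmx).
  by rewrite trmxK trmx0 => w00; rewrite w00 eqxx in w0.
- suff: (n <= m)%N by rewrite leqNgt mn.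
  by move: Kf; rewrite /row_free mxrank_tr => /eqP <-; exact: rank_leq_row.
Qed.

Definition chain_mx n (w : nat -> 'cV[F]_n) : 'M[F]_n := (span_mx w n)^T.

Lemma chain_mx_col n (w : nat -> 'cV[F]_n) (i : 'I_n) :
  chain_mx w *m delta_mx i 0 = w i.
Proof. by apply/colP => a; rewrite -colE !mxE. Qed.

Lemma chain_mx_unit n (T : 'Z_4 -> 'M[F]_n) (w : nat -> 'cV[F]_n) :
  mx_irr T -> w 0%N != 0 ->
  (forall j i, exists a b c,
     T j *m w i = a *: w i.-1 + b *: w i + c *: w i.+1) ->
  chain_mx w \in unitmx.
Proof.
move=> irr w0 hess; rewrite unitmx_tr -row_free_unit /row_free eqn_leq.
by rewrite rank_leq_row (chain_span_rank irr).
Qed.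

Lemma rank_mxsub m n m' n' (f : 'I_m' -> 'I_m) (g : 'I_n' -> 'I_n)
    (A : 'M[F]_(m, n)) : (\rank (mxsub f g A) <= \rank A)%N.
Proof.
rewrite mxsubrc; apply: leq_trans (mxrankS (rowsub_sub _ _)) _.
rewrite -mxrank_tr trmx_mxsub -[X in (_ <= X)%N]mxrank_tr.
by rewrite mxrankS ?rowsub_sub.
Qed.

(** In the basis w the minor of T_0 - k_0^-1 on the rows 0, 2, 4, ... and the
    columns 0, 1, 3, 5, ... is diagonal with nonzero entries. *)
Lemma hrank_chain h (q k0 k1 k2 k3 : F) (T : 'Z_4 -> 'M[F]_(h.+1.*2)) w :
  k0 != 0 -> q != 0 -> k0 ^+ 2 != 1 ->
  chain_relZ q k0 k1 k2 k3 T w -> chain_mx w \in unitmx ->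
  T 0 *m w 0%N = k0 *: w 0%N ->
  (h.+1 <= hrank k0^-1 (T 0%R))%N.
Proof.
move=> k0n qn k0sq R Wu T0w.
pose K := chain_mx w; pose M := invmx K *m (T 0 - k0^-1%:M) *m K.
have up (l : 'I_h.+1) : (2 * l < h.+1.*2)%N by case: l => l /=; lia.
have op (l : 'I_h.+1) : (2 * l - 1 < h.+1.*2)%N by case: l => l /=; lia.
pose u l := Ordinal (up l); pose o l := Ordinal (op l).
pose D : 'rV[F]_h.+1 := \row_l
  (if l == 0 then k0 - k0^-1 else - (k0^-1 * q ^- (2 * l))).
have Kw i (iP : (i < h.+1.*2)%N) : invmx K *m w i = delta_mx (Ordinal iP) 0.
  by rewrite -(chain_mx_col w (Ordinal iP)) mulmxA mulVmx // mul1mx.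
have E : mxsub u o M = diag_mx D.
  apply/matrixP => l l'; rewrite [LHS]mxE [RHS]mxE [D _ _]mxE.
  have -> : M (u l) (o l') =
      (invmx K *m ((T 0 - k0^-1%:M) *m w (o l'))) (u l) 0.
    rewrite -(chain_mx_col w (o l')) !mulmxA -/K -/M.
    by rewrite -colE [RHS]mxE.
  rewrite mulmxBl mul_scalar_mx.
  have [l'0|l'0] := eqVneq l' 0.
    have -> : w (o l') = w 0%N by rewrite l'0.
    rewrite T0w -scalerBl -scalemxAr (Kw 0%N isT) !mxE -val_eqE /= l'0.
    have -> : (l == 0) = (val l == 0%N) by [].
    by rewrite mul2n double_eq0 andbT; case: eqP; rewrite ?mulr1 ?mulr0.
  have l'pos : (0 < l')%N by rewrite lt0n.
  pose i := (2 * l'.-1)%N.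
  have oE : o l' = i.+1 :> nat.
    by rewrite /i /=; move: l'pos; move: (nat_of_ord l') => m; lia.
  have uE : u l' = i.+2 :> nat.
    by rewrite /i /=; move: l'pos; move: (nat_of_ord l') => m; lia.
  have iodd : ~~ odd i by rewrite /i mul2n odd_double.
  rewrite oE (chain_t0_odd R iodd) -uE -oE scalerBr addrAC -scalerBl.
  rewrite mulmxBr -!scalemxAr (Kw _ (op l')) (Kw _ (up l')) !mxE -!val_eqE /=.
  have -> : (2 * l == 2 * l' - 1)%N = false by apply/eqP; lia.
  rewrite andbT eqn_pmul2l // mulr0 sub0r.
  have [->|ll'] := eqVneq l l'.
    by rewrite !eqxx mulr1 eqn0Ngt l'pos.
  by rewrite -[(_ == _ :> nat)]/(l == l') (negbTE ll') mulr0 oppr0.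
have rM : (\rank M <= hrank k0^-1 (T 0%R))%N.
  by apply: leq_trans (mxrankM_maxl _ _) _; apply: mxrankM_maxr.
apply: leq_trans rM.
have rD : \rank (diag_mx D) = h.+1.
  apply/mxrank_unit; rewrite unitmxE det_diag unitfE prodf_seq_neq0.
  apply/allP => l _ /=; rewrite mxE; case: ifP => _.
    rewrite subr_eq0; apply: contra k0sq => /eqP e.
    by rewrite expr2 {1}e mulVf.
  by rewrite oppr_eq0 mulf_neq0 ?invr_eq0 ?expf_neq0.
by have := rank_mxsub u o M; rewrite E rD.
Qed.

End ChainBasis.

(** * Irreducible quadruples of even size come from E *)

Section Classification.
Variables (F : closedFieldType) (q : F).
Hypothesis q0 : q != 0.
Hypothesis q_nroot : forall n : nat, (0 < n)%N -> ~~ n.-unity_root q.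

(** The exceptional index is 0. For i <> 0 one of the ranks of T_i - k_i and
    T_i - k_i^-1 is thus n / 2, and as their sum is at most n the other one is
    not larger. *)
Lemma irr_low k n (T : 'Z_4 -> 'M[F]_n) :
  daha_mx q k T -> mx_irr T -> ~~ odd n -> (2 * hrank (k 0%R) (T 0%R) < n)%N ->
  low_rank T k.
Proof.
move=> qkT irr n_even low0.
have [j [_ _ kother]] := irr_even q0 q_nroot (daha_mx_flip _ qkT) irr
  (low_signP qkT) n_even.
have s0 : low_sign T k 0 = false by rewrite /low_sign ltnNge ltnW.
have j0 : j = 0.
  apply/eqP; apply: contraT; rewrite eq_sym => /kother.
  by rewrite /flip_sign s0 => nE; move: low0; rewrite -nE ltnn.
move=> i; have [->|i0] := eqVneq i 0; first exact: ltnW.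
have := kother i; rewrite j0 => /(_ i0); rewrite /flip_sign.
case: ifP => [|_ <- //]; rewrite /low_sign => lt nE.
have [k0 kT _] := qkT; have := hecke_rankV (k0 i) (kT i).
by move: lt nE; move: (hrank _^-1 _) (hrank _ _) => a b; lia.
Qed.

Lemma common_eigenvector n (A B : 'M[F]_n) a b :
  (hrank a A + hrank b B < n)%N ->
  exists v : 'cV_n, [/\ v != 0, A *m v = a *: v & B *m v = b *: v].
Proof.
move=> lt; pose M := row_mx (A - a%:M)^T (B - b%:M)^T.
have rM : (\rank M < n)%N.
  apply: leq_ltn_trans lt; rewrite -mxrank_tr tr_row_mx !trmxK -addsmxE.
  exact: mxrank_adds_leqif.
have : kermx M != 0 by rewrite -mxrank_eq0 mxrank_ker -lt0n subn_gt0.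
case/rowV0Pn => u /sub_kermxP; rewrite mul_mx_row => /eqP.
rewrite row_mx_eq0 => /andP[/eqP uA /eqP uB] u0; exists u^T; split.
- by apply: contra u0 => /eqP e; rewrite -[u]trmxK e trmx0.
- apply/eqP; rewrite -subr_eq0 -mul_scalar_mx -mulmxBl.
  by rewrite -[_ *m _]trmxK trmx_mul trmxK uA trmx0.
- apply/eqP; rewrite -subr_eq0 -mul_scalar_mx -mulmxBl.
  by rewrite -[_ *m _]trmxK trmx_mul trmxK uB trmx0.
Qed.

Variables (d : nat) (hd : odd d).

Lemma chain_intertwiner k0 k1 k2 k3 (T : 'Z_4 -> 'M[F]_d.+1) w :
  q ^- d.+1 = k0 ^+ 2 -> k0 != 0 ->
  chain_relZ q k0 k1 k2 k3 T w -> w d.+1 = 0 ->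
  forall j, T j *m chain_mx w = chain_mx w *m E_t q d k0 k1 k2 k3 j.
Proof.
move=> k0q k0n R wd.
have KE i : (i <= d)%N -> chain_mx w *m Ev d i = w i.
  by move=> id; rewrite chain_mx_col inordK.
have lastE i : ~~ odd i -> (i.+1 <= d)%N -> i.+1 != d -> (i.+2 <= d)%N.
  by move=> oi id iD; rewrite ltn_neqAle iD id.
move=> j; apply: E_mx_ext; apply: even_or_odd => // i oi id.
have id' : (i <= d)%N by rewrite ltnW.
have im : (i.-1 <= d)%N by apply: leq_trans (leq_pred _) _.
have oi1 : odd i.+1 by [].
rewrite -!(mulmxA (T j)) -!(mulmxA (chain_mx w)) !KE //.
move: j; apply: Z4_ind; split.
- rewrite (chain_t0_even R oi) A0_even // mulmxDr -!scalemxAr !KE //.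
  by rewrite /chain_f !mulrA.
- rewrite (chain_t0_odd R oi); have [iD|/lastE id2] := eqVneq i.+1 d.
    (* Here k0^-1 q^-(d+1) is k0, the eigenvalue of t_0 on v_d. *)
    rewrite iD wd A0_d // -scalemxAr KE // subr0 k0q expr2 mulrA mulVf //.
    by rewrite mul1r.
  by rewrite A0_odd ?id2 // -scalemxAr mulmxBr !KE // id2.
- rewrite (chain_t1_even R oi) A1_even // !mulmxDr -!scalemxAr !KE //.
  by rewrite /chain_f !mulrA.
- by rewrite (chain_t1_odd R oi) A1_odd // -scalemxAr KE.
- by rewrite (chain_t2_even R oi) A2_even // -scalemxAr mulmxBr !KE.
- by rewrite (chain_t2_odd R oi) A2_odd // mulmxDr -!scalemxAr !KE.
- by rewrite (chain_t3_even R oi) A3_even // -scalemxAr !KE.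
- rewrite (chain_t3_odd R oi) A3_odd // !mulmxDr -!scalemxAr !KE //.
  rewrite /chain_g !mulrA; have [iD|iD] := eqVneq i.+1 d.
    by rewrite [w i.+2](_ : _ = 0) ?scaler0 ?mulmx0 // iD.
  by rewrite -scalemxAr KE // lastE.
Qed.

(** If w (d+1) were nonzero it would be a common eigenvector with eigenvalues
    k_0^-1 and k_3; its own chain would again be a basis, and the rank of
    T_0 - k_0 would be at least (d + 1) / 2. *)
Theorem irr_iso_E k0 k1 k2 k3 (T : 'Z_4 -> 'M[F]_d.+1) :
  daha_mx q (quad_fun k0 k1 k2 k3) T -> mx_irr T ->
  (2 * hrank k0 (T 0%R) < d.+1)%N ->
  k0 ^+ 2 = q ^- d.+1 /\ exists2 P, P \in unitmx &
    forall j, T j *m P = P *m E_t q d k0 k1 k2 k3 j.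
Proof.
move=> qkT irr low0; have n_even : ~~ odd d.+1 by rewrite /= hd.
have low := irr_low qkT irr n_even low0.
have [j [nj kj kother]] := irr_even q0 q_nroot qkT irr low n_even.
have j0 : j = 0.
  apply/eqP; apply: contraT; rewrite eq_sym => /kother.
  by move=> nE; move: low0; rewrite {2}nE ltnn.
move: nj kj kother; rewrite {j}j0 => n0 k0q kother.
have [kn kT prodT] := qkT; have k0n : k0 != 0 := kn 0.
have r3 : (hrank k0 (T 0%R) + hrank k3 (T 3%R) < d.+1)%N.
  have l3 : (2 * hrank k3 (T 3%R) <= d.+1)%N := low 3.
  by move: low0 l3; move: (hrank k0 _) (hrank k3 _) => a b; lia.
have [v [v0 T0v T3v]] := common_eigenvector r3.
have [w [w0 R]] := chain_exists qkT q0 T0v T3v.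
have w0n : w 0%N != 0 by rewrite w0.
have Wu := chain_mx_unit irr w0n (chain_hess R).
have qd : k0 ^+ 2 * q ^+ d.+1 = 1 by rewrite k0q mulVf ?expf_neq0.
have wd : w d.+1 = 0.
  apply/eqP; apply: contraT => v'0.
  have T0v' : T 0 *m w d.+1 = k0^-1 *: w d.+1.
    rewrite (chain_t0_even R n_even) /chain_f qd subrr !mulr0 scale0r add0r.
    by rewrite -k0q expr2 mulrA mulVf // mul1r addrAC subrr add0r.
  have T3v' := chain_t3_even R n_even.
  have qkT' : daha_mx q (quad_fun k0^-1 k1 k2 k3) T.
    split=> //; apply: Z4_ind; rewrite ?invr_eq0 //;
      [exact: kn 1|exact: kn 2|exact: kn 3|exact: heckeV (kT 0)
      |exact: kT 1|exact: kT 2|exact: kT 3].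
  have [w' [w'0 R']] := chain_exists qkT' q0 T0v' T3v'.
  have w'0n : w' 0%N != 0 by rewrite w'0.
  have W'u := chain_mx_unit irr w'0n (chain_hess R').
  have T0w' : T 0 *m w' 0%N = k0^-1 *: w' 0%N by rewrite w'0.
  have k0sq : k0^-1 ^+ 2 != 1.
    rewrite exprVn invr_eq1 k0q; apply/negP => /eqP e.
    suff : d.+1 = 0%N by [].
    by apply: (q_expn_inj q0 q_nroot); rewrite e expr0 invr1.
  have [h dE] : exists h, d.+1 = h.+1.*2.
    by exists d./2; rewrite doubleS -[in LHS](odd_double_half d) hd.
  move: low0.
  move: (T) (w') R' W'u T0w'; rewrite dE => T' w'' R'' Wu'' T0w''.
  have k0Vn : k0^-1 != 0 by rewrite invr_eq0.
  have := hrank_chain k0Vn q0 k0sq R'' Wu'' T0w''; rewrite invrK.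
  by move: (hrank _ _) => a ha; rewrite -mul2n ltn_mul2l /= ltnNge ha.
split=> //; exists (chain_mx w) => //.
exact: chain_intertwiner.
Qed.
End Classification.

(** * Irreducibility and equivalence of the modules E *)

Section Conjugation.
Variable F : closedFieldType.

Lemma hrank_conj n (T T' P : 'M[F]_n) k : P \in unitmx ->
  T *m P = P *m T' -> hrank k T = hrank k T'.
Proof.
move=> Pu TP; have E : (T - k%:M) *m P = P *m (T' - k%:M).
  by rewrite mulmxBl mulmxBr TP scalar_mxC.
rewrite /hrank -(mxrankMfree (T - _) (B := P)) ?row_free_unit // E.
by rewrite eqmxMfull // row_full_unit.
Qed.

Lemma hecke_conj n (T T' P : 'M[F]_n) k : P \in unitmx ->
  T *m P = P *m T' -> hecke k T' -> hecke k T.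
Proof.
move=> Pu TP h; apply: (row_free_inj (A := P)); first by rewrite row_free_unit.
rewrite -mulmxA TP mulmxA TP -mulmxA h mulmxBl mulmxBr mul1mx mulmx1.
by rewrite -scalemxAl TP scalemxAr.
Qed.

Lemma mx_irr_conj n (T T' : 'Z_4 -> 'M[F]_n) P : P \in unitmx ->
  (forall j, T j *m P = P *m T' j) -> mx_irr T -> mx_irr T'.
Proof.
move=> Pu TP [n0 irr]; split=> // m K KS.
have PK : invmx P *m (P *m K) = K by rewrite mulKmx.
have [j|PK0|PKf] := irr _ (P *m K).
- by have [S TS] := KS j; exists S; rewrite mulmxA TP -!mulmxA TS.
- by left; rewrite -PK PK0 mulmx0.
- by right; move: PKf; rewrite /row_free eqmxMfull // row_full_unit.
Qed.

(** T determines k + k^-1, hence k up to inversion. *)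
Lemma hecke_uniq n (T : 'M[F]_n) a b : (0 < n)%N -> a != 0 -> b != 0 ->
  hecke a T -> hecke b T -> b = a \/ b = a^-1.
Proof.
move=> n0 a0 b0 ha hb; have T0 : T != 0.
  apply/eqP => T0; move: ha; rewrite /hecke T0 mulmx0 scaler0 sub0r.
  move=> /esym/eqP; rewrite oppr_eq0 => /eqP/(congr1 mxrank).
  by rewrite mxrank1 mxrank0 => n00; rewrite n00 in n0.
have : (a + a^-1 - (b + b^-1)) *: T = 0.
  by rewrite scalerBl -[_ *: T](subrK 1%:M) -ha hb subrK subrr.
move/eqP; rewrite scaler_eq0 (negbTE T0) orbF => /eqP E.
have : (b - a) * (b - a^-1) = 0.
  by rewrite -[RHS](mulr0 (- b)) -E; field; rewrite a0 b0.
by move/eqP; rewrite mulf_eq0 !subr_eq0 => /orP[] /eqP ->; [left|right].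
Qed.

End Conjugation.

Definition quad_scalars (F : fieldType) (k : @quad F) : 'Z_4 -> F :=
  let: (k0, k1, k2, k3) := k in quad_fun k0 k1 k2 k3.

Definition E_mx (F : fieldType) (q : F) d (k : @quad F) : 'Z_4 -> 'M[F]_d.+1 :=
  let: (k0, k1, k2, k3) := k in E_t q d k0 k1 k2 k3.

Section EMatrices.
Variables (F : closedFieldType) (q : F).
Hypothesis q0 : q != 0.
Hypothesis q_nroot : forall n : nat, (0 < n)%N -> ~~ n.-unity_root q.
Variables (d : nat) (hd : odd d).

Local Notation Emx := (E_mx q d).

Lemma E_daha_mx k : E_param q d k -> daha_mx q (quad_scalars k) (Emx k).
Proof.
case: k => [[[k0 k1] k2] k3] hk.
have [EV _ _ Eprod] := E_data q0 hd hk; have [k0n k1n k2n k3n _] := hk; split.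
- exact: Z4_ind.
- move=> j; rewrite /hecke.
  have -> : 1%:M = E_t q d k0 k1 k2 k3 j *m E_tV q d k0 k1 k2 k3 j.
    by have := EV j; rewrite -mulmxE => ->.
  rewrite mulmxBr mul_mx_scalar.
  have -> : E_s k0 k1 k2 k3 j = quad_scalars (k0, k1, k2, k3) j
      + (quad_scalars (k0, k1, k2, k3) j)^-1.
    by move: j; apply: Z4_ind.
  by rewrite subKr.
- by rewrite -scalemx1; exact: Eprod.
Qed.

(** The image of t_0 - k_0 is spanned by the images of v_i for odd i < d: both
    v_0 and v_d are killed, and v_(i+1) and (1 - q^(i+1)) v_i have the same
    image. *)
Lemma E_hrank k : E_param q d k ->
  (2 * hrank (quad_scalars k 0%R) (Emx k 0%R) < d.+1)%N.
Proof.
case: k => [[[k0 k1] k2] k3] [k0n _ _ _ k0q].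
pose N : 'M[F]_d.+1 := E_t q d k0 k1 k2 k3 0 - k0%:M.
rewrite -[quad_scalars _ _]/k0 -[Emx _ _]/(E_t q d k0 k1 k2 k3 0) /hrank.
rewrite -/N -mxrank_tr.
pose w l := N *m Ev d (2 * l).+1.
have NE i : N *m Ev d i = E_t q d k0 k1 k2 k3 0 *m Ev d i - k0 *: Ev d i.
  by rewrite mulmxBl mul_scalar_mx.
have oddw i : odd i -> (i < d)%N -> ((N *m Ev d i)^T <= span_mx w d./2)%MS.
  move=> oi id; have iE : i = (2 * i./2).+1.
    by rewrite mul2n -[in LHS](odd_double_half i) oi.
  rewrite {1}iE; apply: (span_mxP w).
  by move: id hd oi => id /odd_halfK dE /odd_halfK iE2; lia.
have : (N^T <= span_mx w d./2)%MS.
  apply/row_subP => i; have -> : row i N^T = (N *m Ev d i)^T.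
    by rewrite /Ev inord_val -colE tr_col.
  have id := leq_ord i; move: (nat_of_ord i) id => {}i.
  case: (boolP (odd i)) => oi id.
    move: id; rewrite leq_eqVlt => /predU1P[->|]; last exact: oddw.
    by rewrite NE A0_d // subrr trmx0 sub0mx.
  case: i oi id => [|i] oi id.
    rewrite NE A0_even // expr0 subrr !(mulr0, mul0r) scale0r add0r.
    by rewrite invr1 mulr1 addrK subrr trmx0 sub0mx.
  have oi' : odd i by rewrite /= negbK in oi.
  have -> : N *m Ev d i.+1 = (1 - q ^+ i.+1) *: (N *m Ev d i).
    rewrite !NE A0_even // A0_odd //=.
    move: (Ev d i) (Ev d i.+1) => x y; apply/colP => a; rewrite !mxE.
    field.
    by rewrite k0n expf_neq0.
  by rewrite linearZ scalemx_sub // oddw.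
move/mxrankS/leq_trans/(_ (rank_leq_row _)).
by move: (\rank _) hd => r /odd_halfK dE; lia.
Qed.

Lemma flip_quad_scalars (s : 'Z_4 -> bool) (k0 k1 k2 k3 : F) : s 0 = false ->
  flip_sign s (quad_scalars (k0, k1, k2, k3)) =
  quad_scalars (sign_act (k0, k1, k2, k3) (s 1, s 2, s 3)).
Proof. by move=> s0; apply/funext; apply: Z4_ind; rewrite /flip_sign ?s0. Qed.

Lemma EP_irr k : EP q d k -> mx_irr (Emx k).
Proof.
move=> hk; have [kp _] := hk.
apply: (daha_mx_irr (k := quad_scalars k) (q := q)) => //.
- by rewrite /= hd.
- by case: k kp {hk} => [[[k0 k1] k2] k3] [].
- move=> s i s0 oi id; move: hk; case: k {kp} => [[[k0 k1] k2] k3] hk.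
  rewrite flip_quad_scalars // big_Z4.
  have [_ /(_ i oi id)[]] := sign_act_EP q0 hd (s 1, s 2, s 3) hk.
  by [].
- exact: E_daha_mx.
- exact: E_hrank.
Qed.

(** The matrices of E(k) satisfy the same relations for every choice of signs,
    so by the classification they are equivalent to those of each of the other
    modules E attached to the orbit. *)
Lemma E_sign_iso k s : E_param q d k -> mx_irr (Emx k) ->
  exists2 P, P \in unitmx & forall j, Emx k j *m P = P *m Emx (sign_act k s) j.
Proof.
move=> kp irr; have qkE := E_daha_mx kp; have low := E_hrank kp.
case: k s kp irr qkE low => [[[k0 k1] k2] k3] [[s1 s2] s3] kp irr qkE low.
pose s : 'Z_4 -> bool := fun j =>
  match val j with 0 => false | 1 => s1 | 2 => s2 | _ => s3 end.
have qsE := daha_mx_flip s qkE; rewrite flip_quad_scalars //= in qsE.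
by have [_] := irr_iso_E q0 q_nroot hd qsE irr low.
Qed.

(** If the coefficient of v_(i-1) in t_2 v_i and t_3 v_i vanished, then
    v_i, ..., v_d would span a proper invariant subspace. *)
Lemma irr_chain_g k0 k1 k2 k3 i : mx_irr (E_t q d k0 k1 k2 k3) ->
  odd i -> (i <= d)%N -> chain_g k0 k1 k2 k3 (q ^+ i) != 0.
Proof.
move=> [_ irr] oi id; apply/eqP => g0.
pose S := span_mx (fun a => Ev d (i + a) : 'cV[F]_d.+1) (d.+1 - i).
have ES l : (i <= l)%N -> (l <= d)%N -> ((Ev d l : 'cV[F]_d.+1)^T <= S)%MS.
  move=> il ld; rewrite -(subnKC il).
  by apply: (span_mxP (fun a => Ev d (i + a))); lia.
have i0 : (0 < i)%N by case: i oi {id g0 S ES}.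
have [|/eqP S0|Sf] := irr _ S^T.
- move=> j; have : (S *m (E_t q d k0 k1 k2 k3 j)^T <= S)%MS.
    apply/row_subP => a; rewrite row_mul rowK -trmx_mul.
    have am : (i + a <= d)%N by case: a => a /=; lia.
    have il : (i <= i + a)%N by rewrite leq_addr.
    move: (i + a)%N am il => l {a} ld il.
    have spZ c (x : 'cV[F]_d.+1) : (x^T <= S)%MS -> ((c *: x)^T <= S)%MS.
      by move=> xS; rewrite linearZ scalemx_sub.
    have spD (x y : 'cV[F]_d.+1) :
        (x^T <= S)%MS -> (y^T <= S)%MS -> ((x + y)^T <= S)%MS.
      by move=> xS yS; rewrite linearD addmx_sub.
    have spB (x y : 'cV[F]_d.+1) :
        (x^T <= S)%MS -> (y^T <= S)%MS -> ((x - y)^T <= S)%MS.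
      by move=> xS yS; rewrite -scaleN1r; apply/spD/spZ.
    have spl : ((Ev d l)^T <= S)%MS by exact: ES.
    have spS : l != d -> ((Ev d l.+1)^T <= S)%MS.
      by move=> lD; apply: ES; [exact: leqW|rewrite ltn_neqAle lD].
    have spP c : (odd l -> l = i -> c = 0) -> ((c *: Ev d l.-1)^T <= S)%MS.
      case: (ltnP i l) => [lt _|ge c0].
        by apply/spZ/ES; case: l lt ld {il spl spS} => // l lt; exact: ltnW.
      have li : l = i by apply/eqP; rewrite eqn_leq ge.
      by rewrite c0 ?li // scale0r trmx0 sub0mx.
    have [ol|/negbNE ol] := boolP (~~ odd l).
      have lD : l != d by apply: contraNneq ol => ->.
      have liF c : odd l -> l = i -> c = 0 :> F by rewrite (negbTE ol).
      move: j; apply: Z4_ind.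
      - by rewrite A0_even //; apply/spD; [exact: spP (liF _)|exact: spZ].
      - rewrite A1_even //; apply/spD; last exact/spZ/spS.
        by apply/spD; [exact: spP (liF _)|exact: spZ].
      - by rewrite A2_even //; apply/spZ/spB => //; exact: spS.
      - by rewrite A3_even //; apply/spZ.
    move: j; apply: Z4_ind.
    - have [->|lD] := eqVneq l d; first by rewrite A0_d //; apply/spZ/ES.
      by rewrite A0_odd ?ltn_neqAle ?lD //; apply/spZ/spB => //; exact: spS.
    - by rewrite A1_odd //; apply/spZ.
    - rewrite A2_odd //; apply/spD; [apply/spP => _ ->|exact: spZ].
      by move: g0; rewrite /chain_g => ->; rewrite mul0r.
    - rewrite A3_odd //; apply/spD; first apply/spD.
      + apply/spP => _ ->; rewrite -mulrA.
        by move: g0; rewrite /chain_g => ->; rewrite mulr0 oppr0.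
      + exact: spZ.
      + by case: eqVneq => lD; [rewrite trmx0 sub0mx|exact/spZ/spS].
  case/submxP => D E; exists D^T.
  by rewrite -[LHS]trmxK trmx_mul trmxK E trmx_mul.
- have S00 : S = 0 by rewrite -[LHS]trmxK (eqP S0) trmx0.
  case/submxP: (ES i (leqnn _) id) => D; rewrite S00 mulmx0.
  move=> /(congr1 trmx); rewrite trmxK trmx0 => /colP/(_ (inord i)).
  by rewrite !mxE !eqxx => /eqP; rewrite oner_eq0.
- suff: (d.+1 <= d.+1 - i)%N by lia.
  have : \rank S = d.+1 by rewrite -mxrank_tr; apply/eqP.
  by move=> rS; have := rank_leq_row S; rewrite rS.
Qed.

(** The nonvanishing coefficients give the conditions on k_0 k_1 k_2 k_3
    and k_0 k_1 k_2^-1 k_3; the other two come from inverting k_1 or k_3. *)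
Lemma irr_EP k : E_param q d k -> mx_irr (Emx k) -> EP q d k.
Proof.
move=> kp irr; split=> //.
have irrs s : mx_irr (Emx (sign_act k s)).
  have [P Pu EP] := E_sign_iso s kp irr; exact: mx_irr_conj Pu EP irr.
case: k kp irr irrs => [[[k0 k1] k2] k3] [k0n k1n k2n k3n _] irr irrs i oi id.
have qi : q ^+ i != 0 by rewrite expf_neq0.
have prod_neq a b c e : a != 0 -> b != 0 -> c != 0 -> e != 0 ->
    mx_irr (E_t q d a b c e) ->
    a * b * c * e != q ^- i /\ a * b * c^-1 * e != q ^- i.
  move=> an bn cn en /irr_chain_g/(_ oi id).
  rewrite /chain_g mulf_eq0 negb_or !subr_eq0 => /andP[h1 h2]; split.
    apply: contra h2 => /eqP E; apply/eqP.
    apply: (mulIf cn); rewrite mulVf // -[RHS](mulVf qi) -E; ring.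
  apply: contra h1 => /eqP E; apply/eqP.
  have cVn : c^-1 != 0 by rewrite invr_eq0.
  by apply: (mulIf cVn); rewrite mulfV // -[RHS](mulVf qi) -E; ring.
have [p1 p2] := prod_neq _ _ _ _ k0n k1n k2n k3n irr.
have k1Vn : k1^-1 != 0 by rewrite invr_eq0.
have k3Vn : k3^-1 != 0 by rewrite invr_eq0.
have [p3 _] := prod_neq _ _ _ _ k0n k1Vn k2n k3n (irrs (true, false, false)).
have [p4 _] := prod_neq _ _ _ _ k0n k1n k2n k3Vn (irrs (false, false, true)).
by [].
Qed.

(** If the twists differed, t_l with l = e - e' would act on E(k) like t_0 on
    E(k'), so 0 and l would be distinct exceptional indices of E(k). *)
Lemma E_twist_inj k k' e e' (P : 'M[F]_d.+1) : EP q d k -> EP q d k' ->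
  P \in unitmx -> (forall j, Emx k (j + e) *m P = P *m Emx k' (j + e')) ->
  e = e' /\ exists s, k' = sign_act k s.
Proof.
move=> hk hk' Pu EE; have [kp _] := hk; have [kp' _] := hk'.
have irr := EP_irr hk; have qkE := E_daha_mx kp; have low := E_hrank kp.
have qkE' := E_daha_mx kp'; have low' := E_hrank kp'.
have n_even : ~~ odd d.+1 by rewrite /= hd.
have ee' : e = e'.
  apply/eqP; rewrite -subr_eq0; apply: contraT => l0.
  set l := e - e' in l0.
  pose f j := if j == l then quad_scalars k' 0 else quad_scalars k j.
  have E0 : Emx k l *m P = P *m Emx k' 0.
    by have := EE (- e'); rewrite addNr (addrC _ e).
  have [kn kT prodT] := qkE; have [kn' kT' _] := qkE'.
  have qfE : daha_mx q f (Emx k).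
    split=> // j; rewrite /f; case: (eqVneq j l) => [jl|_] //.
    rewrite jl; exact: hecke_conj Pu E0 (kT' 0).
  have f0 : f 0 = quad_scalars k 0 by rewrite /f eq_sym (negbTE l0).
  have flow : (2 * hrank (f 0%R) (Emx k 0%R) < d.+1)%N by rewrite f0.
  have lowf := irr_low q0 q_nroot qfE irr n_even flow.
  have [j [_ _ other]] := irr_even q0 q_nroot qfE irr lowf n_even.
  have [j0|j0] := eqVneq 0 j.
    have := other l; rewrite -j0 l0 => /(_ isT).
    rewrite /f eqxx (hrank_conj _ Pu E0) => nE.
    by move: low'; rewrite {2}nE ltnn.
  by move: flow; rewrite {2}(other 0 j0) ltnn.
split=> //; subst e'.
have {}EE j : Emx k j *m P = P *m Emx k' j by have := EE (j - e); rewrite subrK.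
have kk' j : quad_scalars k' j = quad_scalars k j \/
    quad_scalars k' j = (quad_scalars k j)^-1.
  have [kn kT _] := qkE; have [kn' kT' _] := qkE'.
  apply: (hecke_uniq (T := Emx k j)) => //.
  exact: hecke_conj Pu (EE j) (kT' j).
case: k k' kp kp' kk' {hk hk' EE irr qkE low qkE' low'} =>
  [[[k0 k1] k2] k3] [[[k0' k1'] k2'] k3'].
move=> [k0n _ _ _ k0q] [_ _ _ _ k0q'] kk'.
(* Otherwise k0' = k0^-1, and q^-(2 (d+1)) = k0^2 k0'^2 = 1. *)
have k0E : k0' = k0.
  case: (kk' 0) => // k0V; suff : d.+1.*2 = 0%N by [].
  apply: (q_expn_inj q0 q_nroot); rewrite expr0 invr1 -addnn exprD invfM.
  by rewrite -{1}k0q -k0q' [k0']k0V -exprMn mulfV ?expr1n.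
rewrite k0E.
have [s1 ->] : exists s1 : bool, k1' = if s1 then k1^-1 else k1.
  by case: (kk' 1) => [E|E]; [exists false|exists true].
have [s2 ->] : exists s2 : bool, k2' = if s2 then k2^-1 else k2.
  by case: (kk' 2) => [E|E]; [exists false|exists true].
have [s3 ->] : exists s3 : bool, k3' = if s3 then k3^-1 else k3.
  by case: (kk' 3) => [E|E]; [exists false|exists true].
by exists (s1, s2, s3).
Qed.

End EMatrices.

(** * Modules and matrices *)

Section Modules.
Variables (F : fieldType) (q : F) (hq : q != 0).

Lemma daha_ind (Q : daha hq -> Prop) :
  (forall i, Q (daha_t hq i)) -> (forall i, Q (daha_tV hq i)) ->
  (forall a : F, Q a%:A) -> (forall x y, Q x -> Q y -> Q (x + y)) ->
  (forall x y, Q x -> Q y -> Q (x * y)) -> forall x, Q x.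
Proof.
move=> Qt QtV QA QD QM; apply: (@dclsW F q hq).
elim=> [[] i|a|x Qx y Qy|x Qx y Qy].
- exact: Qt.
- exact: QtV.
- by rewrite dclsS; exact: QA.
- by rewrite dclsD; exact: QD.
- by rewrite dclsM; exact: QM.
Qed.

Lemma isomorphic_irreducible (V W : lmodType (daha hq)) :
  isomorphic V W -> irreducible V -> irreducible W.
Proof.
case=> f [g fK gK] [[x x0] Virr]; split.
  exists (f x); apply: contra x0 => /eqP fx0.
  by rewrite -[x]fK fx0 -(linear0 f) fK.
move=> S [S0 SP] [y yS y0] z.
have in_pre v : (v \in [pred u | f u \in S]) = (f v \in S) by rewrite inE.
rewrite -(gK z).
rewrite -in_pre; apply: Virr.
- split; first by rewrite in_pre linear0.
  by move=> a u v; rewrite !in_pre => uS vS; rewrite linearP SP.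
- exists (g y); first by rewrite in_pre gK.
  by apply: contra y0 => /eqP gy; rewrite -(gK y) gy linear0.
Qed.

Lemma isomorphic_has_dim (V W : lmodType (daha hq)) n :
  isomorphic V W -> has_dim V n -> has_dim W n.
Proof.
case=> f [g fK gK] [b bP]; exists (fun i => f (b i)) => y.
have sumE (c : 'rV[F]_n) : \sum_i ((c 0 i)%:A : daha hq) *: f (b i) =
    f (\sum_i ((c 0 i)%:A : daha hq) *: b i).
  by rewrite linear_sum; apply: eq_bigr => i _; rewrite linearZ.
have [c [cE cU]] := bP (g y); exists c; split; first by rewrite sumE -cE gK.
by move=> c' E; apply: cU; rewrite E sumE fK.
Qed.

Lemma rep_has_dim n (rho : {lrmorphism daha hq -> 'M[F]_n.+1}) :
  has_dim (rep_module rho) n.+1.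
Proof.
have scale_alg a (v : rep_module rho) :
    (a%:A : daha hq) *: v = (a *: (v : 'cV[F]_n.+1) : 'cV_n.+1) :> 'cV_n.+1.
  by rewrite -[LHS]/(rho a%:A *m v) rmorph_alg /= -scalemxAl mul1mx.
exists (fun i => delta_mx i 0) => v.
have sumE (c : 'rV[F]_n.+1) :
    \sum_i ((c 0 i)%:A : daha hq) *: (delta_mx i 0 : rep_module rho) = c^T.
  rewrite [RHS]matrix_sum_delta.
  under [RHS]eq_bigr => i _ do rewrite big_ord1 mxE.
  by apply: eq_bigr => i _; rewrite scale_alg.
exists v^T; split; first by rewrite sumE trmxK.
by move=> c ->; rewrite sumE trmxK.
Qed.

Lemma has_dim_rep (V : lmodType (daha hq)) n : has_dim V n.+1 ->
  exists rho : {lrmorphism daha hq -> 'M[F]_n.+1},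
    isomorphic V (rep_module rho).
Proof.
case=> b bP.
pose psi (c : 'cV[F]_n.+1) : V := \sum_i ((c i 0)%:A : daha hq) *: b i.
have psiD c c' : psi (c + c') = psi c + psi c'.
  rewrite /psi -big_split; apply: eq_bigr => i _.
  by rewrite mxE scalerDl scalerDl.
have psiZ a c : psi (a *: c) = (a%:A : daha hq) *: psi c.
  rewrite /psi scaler_sumr; apply: eq_bigr => i _.
  by rewrite mxE [RHS]scalerA -scalerAl mul1r scalerA.
have [phi phiK] : exists phi : V -> 'cV[F]_n.+1, forall x, psi (phi x) = x.
  have /choice[phi phiK] : forall x, exists c, psi c = x; last by exists phi.
  move=> x; have [c [cE _]] := bP x; exists c^T; rewrite [RHS]cE.
  by apply: eq_bigr => i _; rewrite mxE.
have psiK c : phi (psi c) = c.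
  have [c0 [_ cU]] := bP (psi c).
  have psi_row c' : psi c' = \sum_i ((c'^T 0 i)%:A : daha hq) *: b i.
    by apply: eq_bigr => i _; rewrite mxE.
  have E1 : c0 = c^T by apply: cU; exact: psi_row.
  have E2 : c0 = (phi (psi c))^T by apply: cU; rewrite -psi_row phiK.
  by apply: trmx_inj; rewrite -E2.
have phiD x y : phi (x + y) = phi x + phi y.
  by apply: (can_inj psiK); rewrite psiD !phiK.
have phiZ a x : phi ((a%:A : daha hq) *: x) = a *: phi x.
  by apply: (can_inj psiK); rewrite psiZ !phiK.
have phi0 : phi 0 = 0 by apply: (addrI (phi 0)); rewrite -phiD !addr0.
have phiN u : phi (- u) = - phi u.
  by apply: (addrI (phi u)); rewrite -phiD !subrr.
pose r (x : daha hq) : 'M[F]_n.+1 := \matrix_(i, j) phi (x *: b j) i 0.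
have rE x v : r x *m phi v = phi (x *: v).
  have phi_sum (G : 'I_n.+1 -> V) : phi (\sum_j G j) = \sum_j phi (G j).
    exact: (big_morph phi phiD phi0).
  rewrite -[in RHS](phiK v) /psi scaler_sumr phi_sum.
  apply/colP => i; rewrite mxE summxE; apply: eq_bigr => j _.
  have -> : x *: ((phi v j 0)%:A *: b j) =
      ((phi v j 0)%:A : daha hq) *: (x *: b j).
    by rewrite !scalerA mulr_algl mulr_algr.
  by rewrite phiZ !mxE mulrC.
have ext (A B : 'M[F]_n.+1) : (forall v, A *m phi v = B *m phi v) -> A = B.
  move=> AB; apply/row_matrixP => i; apply: trmx_inj; apply/colP => j.
  have := AB (psi (delta_mx j 0)); rewrite psiK -!colE => /colP/(_ i).
  by rewrite !mxE.
have rB : zmod_morphism r.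
  move=> x y; apply: ext => v; rewrite mulmxBl !rE scalerBl.
  by rewrite phiD phiN.
have rM : monoid_morphism r.
  split; first by apply: ext => v; rewrite rE scale1r mul1mx.
  by move=> x y; apply: ext => v; rewrite -mulmxE -mulmxA !rE scalerA.
have rZ : scalable r.
  move=> a x; apply: ext => v; rewrite -scalemxAl !rE -phiZ scalerA.
  by rewrite mulr_algl.
pose m1 := GRing.isZmodMorphism.Build (daha hq) 'M[F]_n.+1 r rB.
pose m2 := GRing.isMonoidMorphism.Build (daha hq) 'M[F]_n.+1 r rM.
pose m3 := GRing.isScalable.Build F (daha hq) 'M[F]_n.+1 *:%R r rZ.
pose rho : {lrmorphism daha hq -> 'M[F]_n.+1} := HB.pack r m1 m2 m3.
exists rho.
have flin : linear (phi : V -> rep_module rho).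
  by move=> x u v; rewrite phiD -rE.
pose fM := GRing.isLinear.Build (daha hq) V (rep_module rho) *:%R phi flin.
pose f : {linear V -> rep_module rho} := HB.pack (phi : V -> rep_module rho) fM.
by exists f, psi.
Qed.

End Modules.

Section RepModules.
Variables (F : fieldType) (q : F) (hq : q != 0).

Lemma mx_rep_iso n (rho rho' : {lrmorphism daha hq -> 'M[F]_n.+1}) P :
  P \in unitmx ->
  (forall i, rho (daha_t hq i) *m P = P *m rho' (daha_t hq i)) ->
  isomorphic (rep_module rho') (rep_module rho).
Proof.
move=> Pu tP; have allP : forall x, rho x *m P = P *m rho' x.
  apply: daha_ind => [|i|a|x y xP yP|x y xP yP].
  - exact: tP.
  - have [tV Vt _ _] := daha_tP hq.
    have tt (sigma : {lrmorphism daha hq -> 'M[F]_n.+1}) :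
        sigma (daha_t hq i) *m sigma (daha_tV hq i) = 1%:M.
      by rewrite mulmxE -rmorphM tV rmorph1.
    have Vt' : rho (daha_tV hq i) *m rho (daha_t hq i) = 1%:M.
      by rewrite mulmxE -rmorphM Vt rmorph1.
    rewrite -[LHS]mulmx1 -(tt rho') !mulmxA -(mulmxA _ P) -tP.
    by rewrite !mulmxA Vt' mul1mx.
  - by rewrite !rmorph_alg -scalemxAl -scalemxAr mul1mx mulmx1.
  - by rewrite (raddfD rho) (raddfD rho') mulmxDl mulmxDr xP yP.
  - by rewrite !rmorphM /= -!mulmxE -mulmxA yP mulmxA xP mulmxA.
have flin : linear (mulmx P : rep_module rho' -> rep_module rho).
  move=> x u v; apply: etrans (mulmxDr P (rho' x *m u) v) _.
  by rewrite mulmxA -allP -mulmxA.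
pose fM := GRing.isLinear.Build (daha hq) (rep_module rho') (rep_module rho)
  *:%R (mulmx P) flin.
pose f : {linear rep_module rho' -> rep_module rho} :=
  HB.pack (mulmx P : rep_module rho' -> rep_module rho) fM.
exists f, (mulmx (invmx P)) => v; first exact: mulKmx.
exact: mulKVmx.
Qed.

Lemma rep_scale_alg n (rho : {lrmorphism daha hq -> 'M[F]_n.+1}) a
    (v : rep_module rho) :
  (a%:A : daha hq) *: v = (a *: (v : 'cV[F]_n.+1) : rep_module rho).
Proof. by rewrite -[LHS]/(rho a%:A *m v) rmorph_alg /= -scalemxAl mul1mx. Qed.

Lemma rep_iso_mx n (rho rho' : {lrmorphism daha hq -> 'M[F]_n.+1}) :
  isomorphic (rep_module rho') (rep_module rho) ->
  exists2 P, P \in unitmx & forall x, rho x *m P = P *m rho' x.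
Proof.
case=> f [g fK gK].
pose P : 'M[F]_n.+1 := \matrix_(i, j) (f (delta_mx j 0) : 'cV_n.+1) i 0.
have PE (v : 'cV[F]_n.+1) : P *m v = f v.
  rewrite {2}[v]matrix_sum_delta linear_sum.
  apply/colP => i; rewrite summxE mxE; apply: eq_bigr => j _.
  rewrite big_ord1 -rep_scale_alg linearZ /= rep_scale_alg !mxE mulrC.
  by [].
have ext (A B : 'M[F]_n.+1) : (forall v : 'cV_n.+1, A *m v = B *m v) -> A = B.
  move=> AB; apply/row_matrixP => i; apply: trmx_inj; apply/colP => j.
  by have := AB (delta_mx j 0); rewrite -!colE => /colP/(_ i); rewrite !mxE.
exists P; last first.
  move=> x; apply: ext => v; rewrite -!mulmxA !PE.
  exact: (esym (linearZZ f x v)).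
pose Q : 'M[F]_n.+1 := \matrix_(i, j) (g (delta_mx j 0) : 'cV_n.+1) i 0.
suff : P *m Q = 1%:M by case/mulmx1_unit.
apply/row_matrixP => i; apply: trmx_inj; apply/colP => j.
have : P *m col j Q = delta_mx j 0.
  have -> : col j Q = g (delta_mx j 0) by apply/colP => l; rewrite !mxE.
  by rewrite PE gK.
rewrite colE mulmxA -colE => /colP/(_ i); rewrite !mxE => ->.
by rewrite eqxx andbT.
Qed.

Lemma twist_rep n (rho : {lrmorphism daha hq -> 'M[F]_n.+1}) e :
  isomorphic (rep_module (rho \o daha_rot hq e)) (twist e (rep_module rho)).
Proof.
have flin : linear (id : rep_module (rho \o daha_rot hq e) ->
    twist e (rep_module rho)) by [].
pose fM := GRing.isLinear.Build (daha hq) (rep_module (rho \o daha_rot hq e))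
  (twist e (rep_module rho)) *:%R id flin.
pose f : {linear rep_module (rho \o daha_rot hq e) -> twist e (rep_module rho)}
  := HB.pack (id : rep_module (rho \o daha_rot hq e) ->
    twist e (rep_module rho)) fM.
by exists f, id.
Qed.

(** A matrix of maximal rank among those with columns in S spans S. *)
Lemma subspace_mx n (S : 'cV[F]_n -> Prop) : S 0 ->
  (forall a u v, S u -> S v -> S (a *: u + v)) ->
  exists K : 'M[F]_n, forall v, S v <-> exists u, v = K *m u.
Proof.
move=> S0 SP.
pose good r := `[< exists K : 'M[F]_n, (forall u, S (K *m u)) /\ \rank K = r >].
have good0 : exists r, good r.
  exists 0%N; apply/asboolP; exists 0; rewrite mxrank0; split=> // u.
  by rewrite mul0mx.
have good_ub r : good r -> (r <= n)%N.
  by move=> /asboolP[K [_ <-]]; exact: rank_leq_row.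
case: (ex_maxnP good0 good_ub) => r /asboolP[K [KS rK]] rmax.
exists K => v; split=> [Sv|[u ->]//].
have [vK|vK] := boolP (v^T <= K^T)%MS.
  by case/submxP: vK => D E; exists D^T; rewrite -[v]trmxK E trmx_mul trmxK.
have KvS u : S ((K^T + v^T)%MS^T *m u).
  have : (u^T *m (K^T + v^T)%MS <= K^T + v^T)%MS by exact: submxMl.
  case/sub_addsmxP => -[a b] /= E.
  have -> : (K^T + v^T)%MS^T *m u = b 0 0 *: v + K *m a^T.
    rewrite -[LHS]trmxK trmx_mul trmxK E linearD /= !trmx_mul !trmxK addrC.
    congr (_ + _).
    by rewrite [b]mx11_scalar tr_scalar_mx mul_mx_scalar mxE mulr1n.
  exact: SP.
have : good (\rank (K^T + v^T)%MS^T) by apply/asboolP; exists (K^T + v^T)%MS^T.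
move/rmax; rewrite mxrank_tr leqNgt -rK -(mxrank_tr K) rank_ltmx //.
by rewrite ltmxE addsmxSl addsmx_sub submx_refl.
Qed.

End RepModules.

Section RepIrreducible.
Variables (F : closedFieldType) (q : F) (hq : q != 0) (n : nat).
Variable rho : {lrmorphism daha hq -> 'M[F]_n.+1}.
Local Notation T := (fun i => rho (daha_t hq i)).

(** By the quadratic relation t_i^-1 acts as k_i + k_i^-1 - t_i. *)
Lemma rep_stable k m (K : 'M[F]_(n.+1, m)) :
  daha_mx q k T -> (forall i, exists S, T i *m K = K *m S) ->
  forall x, exists S, rho x *m K = K *m S.
Proof.
move=> [kn kT _] KS.
apply: daha_ind => [i|i|a|x y [S xS] [S' yS]|x y [S xS] [S' yS]].
- exact: KS.
- have [S TS] := KS i; exists ((k i + (k i)^-1)%:M - S).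
  have -> : rho (daha_tV hq i) = (k i + (k i)^-1)%:M - T i.
    have [tV Vt _ _] := daha_tP hq.
    have TU : T i *m rho (daha_tV hq i) = 1%:M.
      by rewrite mulmxE -rmorphM tV rmorph1.
    have UT : rho (daha_tV hq i) *m T i = 1%:M.
      by rewrite mulmxE -rmorphM Vt rmorph1.
    have E : T i *m ((k i + (k i)^-1)%:M - T i) = 1%:M.
      have := kT i; rewrite mulmxBr mul_mx_scalar /hecke => ->.
      by rewrite subKr.
    by rewrite -[LHS]mulmx1 -E mulmxA UT mul1mx.
  by rewrite mulmxBl mulmxBr TS scalar_mxC.
- by exists a%:M; rewrite rmorph_alg -scalemxAl mul1mx mul_mx_scalar.
- by exists (S + S'); rewrite raddfD /= mulmxDl mulmxDr xS yS.
- by exists (S *m S'); rewrite rmorphM /= -mulmxE -mulmxA yS mulmxA xS mulmxA.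
Qed.

Lemma col_ext m (A B : 'M[F]_(n.+1, m)) :
  (forall j, A *m (delta_mx j 0 : 'cV_m) = B *m delta_mx j 0) -> A = B.
Proof.
move=> AB; apply/matrixP => i j; have := AB j.
by rewrite -!colE => /colP/(_ i); rewrite !mxE.
Qed.

Lemma irr_rep k : daha_mx q k T -> mx_irr T -> irreducible (rep_module rho).
Proof.
move=> qkT [_ irr]; split.
  exists (delta_mx 0 0 : 'cV[F]_n.+1); apply/eqP => /colP/(_ 0).
  by rewrite !mxE !eqxx => /eqP; rewrite oner_eq0.
move=> S [S0 SP] [x xS x0] y.
have [||K KS] := @subspace_mx F n.+1 (fun v => (v : rep_module rho) \in S).
- exact: S0.
- by move=> a u v uS vS; have := SP a%:A _ _ uS vS; rewrite rep_scale_alg.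
have toS v : (exists u, v = K *m u) -> (v : rep_module rho) \in S.
  by move/(KS v).
have ofS v : (v : rep_module rho) \in S -> exists u, v = K *m u.
  by move/(KS v).
have [i|K0|/row_freeP[B KB]] := irr _ K.
- have : forall j : 'I_n.+1, exists u : 'cV_n.+1,
      T i *m (K *m (delta_mx j 0 : 'cV_n.+1)) = K *m u.
    move=> j; apply: ofS.
    have Kj : (K *m delta_mx j 0 : rep_module rho) \in S.
      by apply: toS; exists (delta_mx j 0).
    by have := SP (daha_t hq i) _ _ Kj S0; rewrite addr0.
  case/choice => u uE; exists (\matrix_(a, j) u j a 0).
  apply: col_ext => j; rewrite -!mulmxA uE; congr (_ *m _).
  by apply/colP => a; rewrite -colE !mxE.
- by case/ofS: xS x0 => u ->; rewrite K0 mul0mx eqxx.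
- by apply: toS; exists (B *m y); rewrite mulmxA KB mul1mx.
Qed.

(** Schur's lemma for a central element, through an eigenspace. *)
Lemma irreducible_central (z : daha hq) : (forall x, GRing.comm z x) ->
  irreducible (rep_module rho) -> exists c, rho z = c%:M.
Proof.
move=> zC [_ irr]; have [c cfree] := mx_eigen (rho z) (ltn0Sn n); exists c.
have [v v0 zv] : exists2 v : 'cV[F]_n.+1, v != 0 & rho z *m v = c *: v.
  have : kermx (rho z - c%:M)^T != 0.
    rewrite -mxrank_eq0 mxrank_ker mxrank_tr -lt0n subn_gt0.
    by rewrite ltn_neqAle cfree rank_leq_row.
  case/rowV0Pn => u /sub_kermxP uz u0; exists u^T.
    by apply: contra u0 => /eqP e; rewrite -[u]trmxK e trmx0.
  apply/eqP; rewrite -subr_eq0 -mul_scalar_mx -mulmxBl.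
  by rewrite -[_ *m _]trmxK trmx_mul trmxK uz trmx0.
pose S : {pred rep_module rho} :=
  [pred w | rho z *m w == c *: (w : 'cV[F]_n.+1)].
have inS w : (w \in S) = (rho z *m w == c *: (w : 'cV[F]_n.+1)).
  by rewrite inE.
apply: col_ext => j; rewrite mul_scalar_mx; apply/eqP; rewrite -inS.
apply: irr; last by exists v; rewrite ?inS ?zv.
split; first by rewrite inS mulmx0 scaler0.
move=> x u w; rewrite !inS => /eqP uS /eqP wS; apply/eqP.
apply: etrans (mulmxDr (rho z) (rho x *m u) w) _.
rewrite wS mulmxA mulmxE -rmorphM zC rmorphM -mulmxE -mulmxA uS.
by rewrite -scalemxAr -scalerDr.
Qed.

(** An equation k + k^-1 = c is quadratic in k, hence solvable. *)
Lemma rep_irr : irreducible (rep_module rho) ->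
  exists k, daha_mx q k T /\ mx_irr T.
Proof.
move=> irr; have [tV Vt _ tP] := daha_tP hq.
have : forall i, exists k, k != 0 /\ hecke k (T i).
  move=> i; have [c cE] := irreducible_central (@daha_t_central _ q hq i) irr.
  have [k kE] := @solve_monicpoly F 2 (fun j => if j == 0%N then -1 else c) isT.
  move: kE; rewrite !big_ord_recl big_ord0 /= expr0 mulr1 expr1 addr0 => kE.
  have k0 : k != 0.
    apply/eqP => k0; move: kE; rewrite k0 expr0n mulr0 addr0 => /eqP.
    by rewrite eq_sym oppr_eq0 oner_eq0.
  exists k; split=> //; rewrite /hecke.
  have -> : k + k^-1 = c.
    apply: (mulIf k0); rewrite mulrDl mulVf // -expr2 kE; ring.
  have tVE : rho (daha_tV hq i) = c%:M - T i.
    by rewrite -cE raddfD /= addrC addKr.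
  have TU : T i *m rho (daha_tV hq i) = 1%:M.
    by rewrite mulmxE -rmorphM tV rmorph1.
  by rewrite -TU tVE mulmxBr mul_mx_scalar subKr.
case/choice => k kP; exists k.
have qkT : daha_mx q k T.
  split=> [i|i|]; [by case: (kP i)|by case: (kP i)|].
  rewrite !mulmxE -!rmorphM; apply: etrans (congr1 rho tP) _.
  by rewrite rmorph_alg; exact: scalemx1.
split=> //; split=> // m K KS.
have [K0|Kn0] := eqVneq K 0; [by left|right].
pose S : {pred rep_module rho} :=
  [pred w | `[< exists u, w = K *m u :> 'cV_n.+1 >]].
have inS w : (w \in S) = `[< exists u, w = K *m u :> 'cV[F]_n.+1 >].
  by rewrite inE.
have all_in (w : rep_module rho) : w \in S.
  have [_] := irr; apply.
    split; first by rewrite inS; apply/asboolP; exists 0; rewrite mulmx0.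
    move=> x u w'; rewrite !inS => /asboolP[a ->] /asboolP[b ->]; apply/asboolP.
    have [S' xS'] := rep_stable qkT KS x; exists (S' *m a + b).
    by rewrite mulmxDr mulmxA -xS' -mulmxA.
  have [j Kj] : exists j, K *m (delta_mx j 0 : 'cV_m) != 0.
    apply/existsP; apply: contraT; rewrite negb_exists => /forallP Kj.
    case/eqP: Kn0; apply: col_ext => j; rewrite mul0mx.
    by apply/eqP; move: (Kj j); rewrite negbK.
  exists (K *m delta_mx j 0 : 'cV_n.+1) => //.
  by rewrite inS; apply/asboolP; exists (delta_mx j 0).
have : forall j : 'I_n.+1, exists u, delta_mx j 0 = K *m u :> 'cV_n.+1.
  move=> j; have := all_in (delta_mx j 0 : 'cV_n.+1).
  by rewrite inS => /asboolP.
case/choice => u uE; apply/row_freeP; exists (\matrix_(a, j) u j a 0).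
apply: col_ext => j; rewrite mul1mx [RHS]uE -mulmxA; congr (_ *m _).
by apply/colP => a; rewrite -colE !mxE.
Qed.

End RepIrreducible.

(** * The classification *)

Section TwistedE.
Variables (F : closedFieldType) (q : F) (hq : q != 0).
Hypothesis q_nroot : forall n : nat, (0 < n)%N -> ~~ n.-unity_root q.
Variables (d : nat) (hd : odd d).
Implicit Types k : @quad F.

Lemma E_module_rep k (hk : E_param q d k) :
  exists2 rho : {lrmorphism daha hq -> 'M[F]_d.+1},
    E_module hq hd hk = rep_module rho &
    forall j, rho (daha_t hq j) = E_mx q d k j.
Proof.
case: k hk => [[[k0 k1] k2] k3] hk.
exists (daha_lift (E_data hq hd hk)) => // j.
exact: daha_lift_t.
Qed.

Lemma twist_E_rep e k (hk : E_param q d k) :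
  exists2 rho : {lrmorphism daha hq -> 'M[F]_d.+1},
    isomorphic (rep_module rho) (twist e (E_module hq hd hk)) &
    forall j, rho (daha_t hq j) = E_mx q d k (j + e).
Proof.
have [rho -> rhoE] := E_module_rep hk.
exists (rho \o daha_rot hq e); first exact: twist_rep.
by move=> j; rewrite /= daha_rotE rhoE.
Qed.

Lemma daha_mx_rot1 kk n (T : 'Z_4 -> 'M[F]_n) : daha_mx q kk T ->
  daha_mx q (fun j => kk (j + 1)) (fun j => T (j + 1)).
Proof.
move=> [kn kT prodT]; split=> //.
have [-> -> -> ->] : [/\ 0 + 1 = 1 :> 'Z_4, 1 + 1 = 2 :> 'Z_4,
    2 + 1 = 3 :> 'Z_4 & 3 + 1 = 0 :> 'Z_4] by split; exact: val_inj.
have : T 0 *m (q *: (T 1 *m T 2 *m T 3)) = 1%:M.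
  by rewrite -scalemxAr !mulmxA prodT scale_scalar_mx mulfV.
move/mulmx1C; rewrite -scalemxAl => E.
by rewrite -[LHS](scalerK hq) E scalemx1.
Qed.

Lemma daha_mx_rot kk n (T : 'Z_4 -> 'M[F]_n) e : daha_mx q kk T ->
  daha_mx q (fun j => kk (j + e)) (fun j => T (j + e)).
Proof.
have ext (kk1 kk2 : 'Z_4 -> F) (T1 T2 : 'Z_4 -> 'M[F]_n) :
    kk1 =1 kk2 -> T1 =1 T2 ->
    daha_mx q kk1 T1 -> daha_mx q kk2 T2 by move=> /funext-> /funext->.
have shift a b : a + 1 = b ->
    (daha_mx q kk T -> daha_mx q (fun j => kk (j + a)) (fun j => T (j + a))) ->
    daha_mx q kk T -> daha_mx q (fun j => kk (j + b)) (fun j => T (j + b)).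
  move=> <- IH /IH/daha_mx_rot1; apply: ext => j;
    by rewrite -addrA (addrC 1).
move: e; apply: Z4_ind.
- by apply: ext => j; rewrite addr0.
- exact: daha_mx_rot1.
- apply: (shift 1); [exact: val_inj|exact: daha_mx_rot1].
- apply: (shift 2); first exact: val_inj.
  apply: (shift 1); [exact: val_inj|exact: daha_mx_rot1].
Qed.

Lemma mx_irr_rot n (T : 'Z_4 -> 'M[F]_n) e :
  mx_irr T <-> mx_irr (fun j => T (j + e)).
Proof.
suff imp (S : 'Z_4 -> 'M[F]_n) c : mx_irr S -> mx_irr (fun j => S (j + c)).
  split=> [|/(imp _ (- e))]; first exact: imp.
  have -> : (fun j => T (j - e + e)) = T by apply/funext => j; rewrite subrK.
  by [].
case=> n0 irr; split=> // m K KS; apply: irr => i.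
by have := KS (i - c); rewrite subrK.
Qed.

Lemma twist_E_irr e k (hk : EP q d k) :
  irreducible (twist e (E_module hq hd (proj1 hk))).
Proof.
have [rho iso rhoE] := twist_E_rep e (proj1 hk).
apply: isomorphic_irreducible iso _.
have TE : (fun j => rho (daha_t hq j)) = (fun j => E_mx q d k (j + e)).
  exact/funext.
apply: (irr_rep (k := fun j => quad_scalars k (j + e))); rewrite TE.
  apply: daha_mx_rot; exact: E_daha_mx (proj1 hk).
by apply: (mx_irr_rot (E_mx q d k) e).1; exact: (EP_irr hq q_nroot hd hk).
Qed.

Lemma twist_E_dim e k (hk : E_param q d k) :
  has_dim (twist e (E_module hq hd hk)) d.+1.
Proof.
have [rho iso _] := twist_E_rep e hk.
exact: isomorphic_has_dim iso (rep_has_dim rho).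
Qed.

Lemma twist_E_iso e k k' (hk : E_param q d k) (hk' : E_param q d k') P :
  P \in unitmx -> (forall j, E_mx q d k j *m P = P *m E_mx q d k' j) ->
  isomorphic (twist e (E_module hq hd hk)) (twist e (E_module hq hd hk')).
Proof.
move=> Pu PE; have [rho iso rhoE] := twist_E_rep e hk.
have [rho' iso' rho'E] := twist_E_rep e hk'.
apply: isomorphic_trans iso'; apply: isomorphic_trans (isomorphic_sym iso) _.
apply/isomorphic_sym/(mx_rep_iso Pu) => i; by rewrite rhoE rho'E PE.
Qed.

Lemma twist_E_inj e e' k k' (hk : EP q d k) (hk' : EP q d k') :
  isomorphic (twist e (E_module hq hd (proj1 hk)))
             (twist e' (E_module hq hd (proj1 hk'))) ->
  e = e' /\ exists s, k' = sign_act k s.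
Proof.
move=> iso; have [rho iso1 rhoE] := twist_E_rep e (proj1 hk).
have [rho' iso1' rho'E] := twist_E_rep e' (proj1 hk').
have : isomorphic (rep_module rho') (rep_module rho).
  apply: isomorphic_trans iso1' _.
  apply: isomorphic_trans (isomorphic_sym iso) _.
  exact: isomorphic_sym.
case/rep_iso_mx => P Pu PE; apply: (E_twist_inj hq q_nroot hd hk hk' Pu) => j.
by rewrite -rhoE -rho'E PE.
Qed.

(** With e the exceptional index of V, rotating the generators by e moves it to
    0, where [irr_iso_E] applies. *)
Lemma irreducible_twist_E (V : lmodType (daha hq)) :
  irreducible V -> has_dim V d.+1 ->
  exists e k (hk : EP q d k),
    isomorphic (twist e (E_module hq hd (proj1 hk))) V.
Proof.
move=> Virr /has_dim_rep[rho Vrho].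
have [kk [qkT irr]] := rep_irr (isomorphic_irreducible Vrho Virr).
pose T j := rho (daha_t hq j); rewrite -/T in qkT irr.
have qkT' := daha_mx_flip (low_sign T kk) qkT.
have n_even : ~~ odd d.+1 by rewrite /= hd.
have [e [ne _ _]] := irr_even hq q_nroot qkT' irr (low_signP qkT) n_even.
set k' := flip_sign _ _ in qkT' ne.
have qkR := daha_mx_rot e qkT'.
have irrR := (mx_irr_rot T e).1 irr.
pose k : @quad F := (k' e, k' (1 + e), k' (2 + e), k' (3 + e)).
have qk : (fun j => k' (j + e)) = quad_scalars k.
  by apply/funext; apply: Z4_ind; rewrite ?add0r.
rewrite qk in qkR.
have low : (2 * hrank (k' e) (T (0 + e)%R) < d.+1)%N.
  by rewrite add0r {2}ne.
have [k0q [P Pu PE]] := irr_iso_E hq q_nroot hd qkR irrR low.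
have kp : E_param q d k by case: qkR => kn _ _; split=> //;
  [exact: kn 0|exact: kn 1|exact: kn 2|exact: kn 3].
have hk : EP q d k.
  by apply: (irr_EP hq q_nroot hd kp); exact: mx_irr_conj Pu PE irrR.
exists (- e), k, hk.
have [rho' iso' rho'E] := twist_E_rep (- e) (proj1 hk).
apply: isomorphic_trans (isomorphic_sym iso') _.
apply: isomorphic_trans (isomorphic_sym Vrho).
apply: (mx_rep_iso Pu) => i; rewrite rho'E.
by have := PE (i - e); rewrite subrK.
Qed.

Lemma sign_orbitE k s : sign_orbit (sign_act k s) = sign_orbit k.
Proof.
apply/funext => k'; apply/propext; case: s => [[s1 s2] s3].
split=> -[[[r1 r2] r3] ->]; first by rewrite sign_actM; eexists.
exists (s1 (+) r1, s2 (+) r2, s3 (+) r3).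
by rewrite sign_actM !addbA !addbb.
Qed.

End TwistedE.

Theorem theorem2p3 (F : closedFieldType) (q : F) (hq : q != 0)
    (q_not_root : forall n : nat, (0 < n)%N -> ~~ n.-unity_root q)
    (d : nat) (hd : odd d) :
  exists E : 'Z_4 * EP_orbits q d -> EM_classes hq d,
    bijective E /\
    forall (e : 'Z_4) (k : quad) (hk : EP q d k),
      sval (E (e, EP_orbit hk)) = iso_class (twist e (E_module hq hd (proj1 hk))).
Proof.
(* The isomorphism class does not depend on the chosen representative, as EE
   shows. *)
pose rep (O : EP_orbits q d) := cid (svalP O).
pose repP O : EP q d (sval (rep O)) := proj1 (svalP (rep O)).
pose Emod e O := twist e (E_module hq hd (proj1 (repP O))).
have EmodP e O : exists V,
    [/\ irreducible V, has_dim V d.+1 & iso_class (Emod e O) = iso_class V].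
  exists (Emod e O); split=> //; [exact: twist_E_irr|exact: twist_E_dim].
pose E (x : 'Z_4 * EP_orbits q d) : EM_classes hq d :=
  exist _ (iso_class (Emod x.1 x.2)) (EmodP x.1 x.2).
have EE e k (hk : EP q d k) :
    sval (E (e, EP_orbit hk)) = iso_class (twist e (E_module hq hd (proj1 hk))).
  apply/iso_class_eq.
  have kr : sign_orbit k = sign_orbit (sval (rep (EP_orbit hk))).
    exact: (proj2 (svalP (rep (EP_orbit hk)))).
  have [s kE] : sign_orbit k (sval (rep (EP_orbit hk))).
    by rewrite kr; exists (false, false, false); rewrite sign_act1.
  have [P Pu PE] :=
    E_sign_iso hq q_not_root hd s (proj1 hk) (EP_irr hq q_not_root hd hk).
  apply/isomorphic_sym/(twist_E_iso hq _ _ _ _ Pu) => j.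
  by rewrite kE PE.
exists E; split=> //.
have Einj : injective E.
  move=> [e O] [e' O'] /(congr1 sval)/iso_class_eq/(twist_E_inj q_not_root).
  rewrite /= => -[-> [s kk']].
  congr (_, _); have := proj2 (svalP (rep O)); have := proj2 (svalP (rep O')).
  rewrite kk' sign_orbitE => O'E OE.
  move: (etrans OE (esym O'E)); case: (O) (O') => [S ?] [S' ?] /=.
  exact: eq_exist.
have Esurj C : exists x, E x = C.
  case: C => C [V [Virr Vdim CE]].
  have [e [k [hk iso]]] := irreducible_twist_E q_not_root hd Virr Vdim.
  exists (e, EP_orbit hk); apply: eq_exist; rewrite CE.
  by apply: etrans (EE e k hk) _; apply/iso_class_eq.
exists (fun C => sval (cid (Esurj C))) => [x|C].
  by apply: Einj; exact: (svalP (cid (Esurj (E x)))).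
exact: (svalP (cid (Esurj C))).
Qed.
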